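(* Let $p$ be a prime and let $a,b,c\in\mathbb{Z}_p$ be such that for every $i=0,1,2,\dots$ $$\min\bigl(\mu_{a^{(i)}},\mu_{b^{(i)}}\bigr)>0\qquad\text{and}\qquad \mu_{c^{(i)}}>\mu_{a^{(i)}}+\mu_{b^{(i)}} .$$ Then the function $\mathcal{F}(a,b,c;\lambda)$, that is, the maximal $p$-adic analytic extension of the ratio $$\frac{F(a,b,c;\lambda)}{F(a',b',c';\lambda^p)}\in 1+\lambda\,\mathbb{Q}_p[[\lambda]],$$ extends analytically to the open disk of radius $1$ around $\lambda=1$, and $$\mathcal{F}(a,b,c;1)=\frac{\Gamma_p(c)\,\Gamma_p(c-a-b)}{\Gamma_p(c-a)\,\Gamma_p(c-b)} .$$
   Context: For $x\in\mathbb{Z}_p$, $x'\in\mathbb{Z}_p$ is the unique element such that $px'-x=\mu_x\in\{0,1,\dots,p-1\}$; this also defines the integer $\mu_x$. Recursively, $x^{(0)}=x$ and $x^{(i+1)}=(x^{(i)})'$. $F(a,b,c;\lambda)=\sum_{s\ge 0}\frac{(a)_s(b)_s}{(c)_s\,s!}\lambda^s$ is the Gauss hypergeometric series, with $(a)_s=a(a+1)\cdots(a+s-1)$. (The hypotheses force $c\in\mathbb{Z}_p^\times$ and $c\notin\mathbb{Z}_{\le 0}$, and similarly for all $c^{(i)}$, so these series make sense.) $\Gamma_p$ is Morita's $p$-adic gamma function. Analytic extension is understood in the sense of Krasner: an analytic function (analytic element) on a subset $S\subset\mathbb{C}_p$ is a uniform limit on $S$ of rational functions without poles in $S$. The assertion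 that $\mathcal{F}(a,b,c;\lambda)$ extends analytically to the open disk $D(1,1^-)=\{\lambda\in\mathbb{C}_p:|\lambda-1|<1\}$ means that there is a set $S$, equal to the closed unit disk of $\mathbb{C}_p$ minus finitely many residue classes (open disks of radius $1$), with $D(0,1^-)\subset S$ and $D(1,1^-)\subset S$, and an analytic element on $S$ whose power series expansion at $0$ is the ratio $\frac{F(a,b,c;\lambda)}{F(a',b',c';\lambda^p)}\in 1+\lambda\,\mathbb{Q}_p[[\lambda]]$; $\mathcal{F}(a,b,c;1)$ is the value of this element at $\lambda=1$. *)

(* Defs.v *)
From mathcomp Require Import all_boot all_order all_algebra.
From mathcomp Require Import boolp classical_sets reals.
Set Implicit Arguments.
Unset Strict Implicit.
Unset Printing Implicit Defensive.
Import Order.TTheory GRing.Theory Num.Theory.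
Local Open Scope classical_set_scope.
Local Open Scope ring_scope.

(* Power series are represented by their coefficient sequences [nat -> K]. *)
Section PowerSeries.
Variable K : fieldType.
Implicit Types (f h : nat -> K) (a b c : K).

(* First [n] coefficients of f / h, solving g * h = f degree by degree. *)
Fixpoint ps_quot_rec f h (n : nat) : seq K :=
  if n is m.+1 then
    let s := ps_quot_rec f h m in
    rcons s ((f m - \sum_(i < m) s`_i * h (m - i)%N) / h 0%N)
  else [::].

Definition ps_quot f h (n : nat) : K := (ps_quot_rec f h n.+1)`_n.

Lemma size_ps_quot_rec f h n : size (ps_quot_rec f h n) = n.
Proof. by elim: n => //= n IHn; rewrite size_rcons IHn. Qed.

Lemma nth_ps_quot_rec f h n i : (i < n)%N -> (ps_quot_rec f h n)`_i = ps_quot f h i.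
Proof.
elim: n => // n IHn; rewrite ltnS leq_eqVlt => /predU1P[-> //|lt_in].
by rewrite /= nth_rcons size_ps_quot_rec lt_in IHn.
Qed.

Lemma ps_quotP f h : h 0%N != 0 ->
  forall n, \sum_(i < n.+1) ps_quot f h i * h (n - i)%N = f n.
Proof.
move=> h0 n; rewrite big_ord_recr /= subnn.
rewrite {2}/ps_quot /= nth_rcons size_ps_quot_rec ltnn eqxx divfK //.
rewrite [X in _ - X](eq_bigr (fun i : 'I_n => ps_quot f h i * h (n - i)%N)); last first.
  by move=> i _; rewrite nth_ps_quot_rec.
by rewrite addrC subrK.
Qed.

(* (a)_s = a (a + 1) ... (a + s - 1) *)
Definition pochhammer a (s : nat) : K := \prod_(i < s) (a + i%:R).

Definition hypergeom a b c (s : nat) : K :=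
  (pochhammer a s * pochhammer b s) / (pochhammer c s * (s`!)%:R).

(* f(lambda ^ p) *)
Definition ps_expand (p : nat) f (n : nat) : K :=
  if (p %| n)%N then f (n %/ p)%N else 0.

End PowerSeries.

Section Padic.
Variables (p : nat) (R : realType) (K : closedFieldType) (v : K -> R).

Definition vclosure (A : set K) : set K :=
  [set x | forall eps : R, 0 < eps -> exists2 y, A y & v (x - y) < eps].

Definition vlim (u : nat -> K) (l : K) : Prop :=
  forall eps : R, 0 < eps ->
    exists N : nat, forall n, (N <= n)%N -> v (u n - l) < eps.

Definition vcauchy (u : nat -> K) : Prop :=
  forall eps : R, 0 < eps ->
    exists N : nat, forall m n, (N <= m)%N -> (N <= n)%N -> v (u m - u n) < eps.

(* Inside C_p, the rings Q_p and Z_p are the closures of Q and Z. *)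
Definition padic_num : set K := vclosure (range (ratr : rat -> K)).
Definition padic_int : set K := vclosure (range (intr : int -> K)).

Definition algebraic_over_Qp (x : K) : Prop :=
  exists q : {poly K}, [/\ q != 0, forall i, padic_num q`_i & root q x].

(* (K, v) is C_p, the completion of an algebraic closure of Q_p, with
   |p| = 1/p: these axioms determine (K, v) up to isometric isomorphism
   (K has characteristic 0 because |p| is neither 0 nor 1). *)
Record is_Cp : Prop := IsCp {
  Cp_abs_ge0 : forall x, 0 <= v x;
  Cp_abs_eq0 : forall x, v x = 0 <-> x = 0;
  Cp_absM : forall x y, v (x * y) = v x * v y;
  Cp_absD : forall x y, v (x + y) <= Num.max (v x) (v y);
  Cp_abs_p : v p%:R = p%:R^-1;
  Cp_complete : forall u, vcauchy u -> exists l, vlim u l;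
  Cp_dense : forall x, vclosure algebraic_over_Qp x
}.

(* x', the unique element of Z_p with p x' - x in {0, ..., p - 1} *)
Definition dprime (x : K) : K :=
  xget 0 [set y | padic_int y /\ exists2 m : nat, (m < p)%N & p%:R * y - x = m%:R].

(* mu_x = p x' - x *)
Definition mu (x : K) : nat :=
  xget 0%N [set m : nat | (m < p)%N /\ p%:R * dprime x - x = m%:R].

(* x^(i) *)
Definition dprime_iter (i : nat) (x : K) : K := iter i dprime x.

(* Morita's function at n : nat is (-1)^n times the product of the j < n
   prime to p; it is extended to Z_p by continuity. *)
Definition Gamma_nat (n : nat) : K :=
  (-1) ^+ n * \prod_(1 <= j < n | ~~ (p %| j)%N) j%:R.

Definition Gamma_p (x : K) : K :=
  xget 0 [set y | forall eps : R, 0 < eps -> exists2 delta : R, 0 < delta &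
    forall n : nat, v (n%:R - x) < delta -> v (Gamma_nat n - y) < eps].

(* D(x, 1^-) *)
Definition open_unit_disk (x : K) : set K := [set y | v (y - x) < 1].

(* The closed unit disk minus finitely many residue classes. *)
Definition residue_domain (S : set K) : Prop :=
  exists2 s : seq K, (forall x, x \in s -> v x <= 1) &
    S = [set y | v y <= 1 /\ forall x, x \in s -> ~ open_unit_disk x y].

Definition analytic_element (S : set K) (f : K -> K) : Prop :=
  forall eps : R, 0 < eps -> exists P Q : {poly K},
    (forall x, S x -> Q.[x] != 0) /\
    (forall x, S x -> v (f x - P.[x] / Q.[x]) < eps).

(* An analytic element on a domain containing D(0, 1^-) is represented on the
   whole of D(0, 1^-) by its power series expansion at 0. *)
Definition has_expansion_at0 (f : K -> K) (g : nat -> K) : Prop :=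
  forall x, open_unit_disk 0 x ->
    vlim (fun n => \sum_(i < n) g i * x ^+ i) (f x).

Definition analytic_extension (g : nat -> K) (S : set K) (f : K -> K) : Prop :=
  [/\ residue_domain S, open_unit_disk 0 `<=` S,
      analytic_element S f & has_expansion_at0 f g].

Definition extends_to (g : nat -> K) (U : set K) : Prop :=
  exists S f, analytic_extension g S f /\ U `<=` S.

(* The maximal analytic extension of g: at x, the common value of all the
   extensions of g defined at x (0 when there is none). *)
Definition max_extension (g : nat -> K) (x : K) : K :=
  xget 0 [set y | exists S f, [/\ analytic_extension g S f, S x & f x = y]].

(* Coefficients of F(a, b, c; lambda) / F(a', b', c'; lambda ^ p). *)
Definition hypergeom_ratio (a b c : K) : nat -> K :=
  ps_quot (hypergeom a b c)
          (ps_expand p (hypergeom (dprime a) (dprime b) (dprime c))).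

Definition calF (a b c : K) : K -> K := max_extension (hypergeom_ratio a b c).

End Padic.

(* Main.v *)
Require Import Defs.
From mathcomp Require Import all_boot all_order all_algebra.
From mathcomp Require Import boolp classical_sets reals.
From mathcomp Require Import ring lra zify.
Import Order.TTheory GRing.Theory Num.Theory.
Local Open Scope classical_set_scope.
Local Open Scope ring_scope.
Set Implicit Arguments.
Unset Strict Implicit.
Unset Printing Implicit Defensive.

(** The digits.  Since p x' - x = mu_x, the numbers mu of x, x', x'', ... are the
    p-adic digits of - x.  Cutting the expansions of - a, - b, - c after n digits
    gives natural numbers N, M, L with - N, - M, - L close to a, b, c; as
    mu_c > mu_a + mu_b at every place, the additions N + M + (L - N - M) = L
    involve no carry.  The series F(- N, - M, - L; lambda) is a polynomial, and
    'C(L, M) F(- N, - M, - L; lambda) is the coefficient of t ^ M in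
      (1 + t) ^ (L - N) * (1 + (1 - lambda) t) ^ N
    ([ev_hyperpoly_sum], [hyperpoly_coefE]).  In this form the polynomial splits
    along the digits, as a product of powers G_j ^ (p ^ j) with deg_t G_j < p
    ([Gprod_hyperG]).

    The limit.  Let r_n be the quotient of the polynomial with n + 1 digits by
    the polynomial with the last n of these digits, taken at lambda ^ p.
    The congruence of Dwork [dwork_ratio] says that r_n and r_(n+1) agree modulo
    p ^ (n + 1) wherever all these polynomials have absolute value 1.  It is
    proved by the ghost terms of Mellit and Vlasenko: G ^ (p ^ (m + j)) differs
    from the m-fold Frobenius twist of G ^ (p ^ j) by a multiple of p ^ (j + 1),
    and coefficients of X(t) * Y(t ^ (p ^ m)) are products of coefficients of X
    and Y as soon as deg X < p ^ m ([coef_decouple]).  All the absolute values are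
    1 where finitely many polynomials, one for each triple of digits, do not
    vanish modulo p: on the closed unit disk without finitely many residue
    classes.  At 0 and at 1 these polynomials are binomial coefficients 'C(k, m)
    with m <= k < p, so that the disks around 0 and 1 remain.  The uniform limit
    of r_n(lambda) / r_n(0) is the analytic element [ratio_ext]; on the disk around
    0 it is the sum of the quotient of power series because the coefficients of
    the polynomials converge to those of the hypergeometric series and are
    integral ([ratio_ext_expansion]).  All extensions agree at 1 by
    [analytic_element_uniq].

    The value.  For lambda = 1 the generating polynomial is (1 + t) ^ (L - N), so
    r_n(1) is a quotient of binomial coefficients, hence of products of integers
    prime to p ([bin_pfact], [ratio_n_at1]).  These products are, up to sign and
    modulo powers of p, the inverses of values of Morita's function
    ([Gamma_reflect], a form of the reflection formula that rests on Wilson's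
    theorem modulo p ^ k), and the signs cancel. *)

(** * Ultrametric estimates and limits in C_p *)

Section Valued.
Variables (p : nat) (R : realType) (K : closedFieldType) (v : K -> R).
Hypotheses (p_prime : prime p) (Cp : is_Cp p v).

(** The absolute value of p ^ k. *)
Definition pabs (k : nat) : R := p%:R^-1 ^+ k.

Lemma pR_gt0 : 0 < p%:R :> R. Proof. by rewrite ltr0n prime_gt0. Qed.
Lemma pR_inv_lt1 : p%:R^-1 < 1 :> R.
Proof. by rewrite invf_lt1 ?pR_gt0 // ltr1n prime_gt1. Qed.
Lemma pabs_gt0 k : 0 < pabs k.
Proof. by rewrite exprn_gt0 // invr_gt0 pR_gt0. Qed.
Lemma pabsD j k : pabs (j + k) = pabs j * pabs k.
Proof. by rewrite /pabs exprD. Qed.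
Lemma pabs0 : pabs 0 = 1. Proof. by []. Qed.
Lemma pabs1 : pabs 1 = p%:R^-1. Proof. by []. Qed.
Lemma pabs_le j k : (j <= k)%N -> pabs k <= pabs j.
Proof.
move=> jk; rewrite -(subnK jk) pabsD ler_piMl ?(ltW (pabs_gt0 _)) //.
by apply: exprn_ile1; [rewrite invr_ge0 ltW ?pR_gt0|rewrite ltW ?pR_inv_lt1].
Qed.
Lemma pabs_lt j k : (j < k)%N -> pabs k < pabs j.
Proof.
move=> jk; apply: le_lt_trans (pabs_le jk) _.
by rewrite -addn1 pabsD pabs1 gtr_pMr ?pabs_gt0 ?pR_inv_lt1.
Qed.

Lemma pabs_small (e : R) : 0 < e -> exists k, pabs k < e.
Proof.
move=> e0; have [k hk] : exists k : nat, e^-1 < k%:R.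
  by exists (Num.bound e^-1); apply: archi_boundP; rewrite invr_ge0 ltW.
exists k; rewrite /pabs exprVn -[ltRHS]invrK ltf_pV2 ?posrE ?invr_gt0 ?exprn_gt0 ?pR_gt0 //.
apply: lt_le_trans hk _.
by rewrite -natrX ler_nat ltnW // ltn_expl ?prime_gt1.
Qed.

Lemma geom_small (t e : R) : 0 <= t -> t < 1 -> 0 < e ->
  exists m, forall n, (m <= n)%N -> t ^+ n < e.
Proof.
move=> t0 t1 e0.
suff [m hm] : exists m, t ^+ m < e.
  by exists m => n mn; apply: le_lt_trans hm; apply: ler_wiXn2l => //; apply: ltW.
have [tz|tn0] := eqVneq t 0; first by exists 1%N; rewrite tz expr1.
have tp : 0 < t by rewrite lt_def tn0.
pose h := t^-1 - 1.
have h0 : 0 < h by rewrite subr_gt0 invf_gt1.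
(* Bernoulli's inequality *)
have bern n : 1 + n%:R * h <= t^-1 ^+ n.
  elim: n => [|n IHn]; first by rewrite mul0r addr0.
  rewrite exprS; apply: (@le_trans _ _ (t^-1 * (1 + n%:R * h))); last first.
    by apply: ler_wpM2l IHn; rewrite invr_ge0.
  have -> : t^-1 = h + 1 by rewrite subrK.
  rewrite -natr1; have := mulr_ge0 (ler0n R n) (sqr_ge0 h); nra.
have [k hk] : exists k : nat, e^-1 / h < k%:R.
  by exists (Num.bound (e^-1 / h)); apply: archi_boundP; rewrite divr_ge0 ?invr_ge0 // ltW.
exists k; rewrite -[ltRHS]invrK -[ltLHS]invrK ltf_pV2 ?posrE ?invr_gt0 ?exprn_gt0 //.
rewrite -exprVn; apply: lt_le_trans (bern k).
by move: hk; rewrite ltr_pdivrMr // => hk; nra.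
Qed.

Let v_ge0 := Cp_abs_ge0 Cp.

Lemma v0 : v 0 = 0. Proof. by apply/(Cp_abs_eq0 Cp). Qed.
Lemma v_neq0 x : x != 0 -> v x != 0.
Proof. by apply: contra_neq => /(Cp_abs_eq0 Cp). Qed.
Lemma v_gt0 x : x != 0 -> 0 < v x.
Proof. by move=> x0; rewrite lt_def v_neq0 // v_ge0. Qed.
Lemma vM x y : v (x * y) = v x * v y. Proof. exact: Cp_absM Cp x y. Qed.
Lemma v1 : v 1 = 1.
Proof.
have : v 1 != 0 by rewrite v_neq0 ?oner_neq0.
by move=> /mulfI; apply; rewrite -vM !mulr1.
Qed.
Lemma vX x n : v (x ^+ n) = v x ^+ n.
Proof. by elim: n => [|n IH]; rewrite ?v1 // !exprS vM IH. Qed.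
Lemma v_neq0_of x : v x = 1 -> x != 0.
Proof. by apply: contra_eq_neq => ->; rewrite v0 eq_sym oner_neq0. Qed.
Lemma vV x : v x^-1 = (v x)^-1.
Proof.
have [->|x0] := eqVneq x 0; first by rewrite invr0 v0 invr0.
by apply: (mulfI (v_neq0 x0)); rewrite -vM !divff ?v1 ?v_neq0.
Qed.
Lemma vN x : v (- x) = v x.
Proof.
have h : v (-1) = 1.
  have /eqP := vX (-1) 2; rewrite sqrrN expr1n v1 eq_sym sqrf_eq1 => /orP[/eqP//|/eqP h].
  by have := v_ge0 (-1); rewrite h lerNr oppr0 ler10.
by rewrite -mulN1r vM h mul1r.
Qed.
Lemma v_sign n : v ((-1) ^+ n) = 1.
Proof. by rewrite vX vN v1 expr1n. Qed.
Lemma vBC x y : v (x - y) = v (y - x). Proof. by rewrite -vN opprB. Qed.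
Lemma vD_le x y r : v x <= r -> v y <= r -> v (x + y) <= r.
Proof. by move=> hx hy; apply: le_trans (Cp_absD Cp x y) _; rewrite ge_max hx. Qed.
Lemma vD_lt x y r : v x < r -> v y < r -> v (x + y) < r.
Proof. by move=> hx hy; apply: le_lt_trans (Cp_absD Cp x y) _; rewrite gt_max hx. Qed.
Lemma vB_le x y r : v x <= r -> v y <= r -> v (x - y) <= r.
Proof. by move=> hx hy; apply: vD_le; rewrite ?vN. Qed.
Lemma vB_lt x y r : v x < r -> v y < r -> v (x - y) < r.
Proof. by move=> hx hy; apply: vD_lt; rewrite ?vN. Qed.
Lemma v_dist_le z x y r : v (x - z) <= r -> v (z - y) <= r -> v (x - y) <= r.
Proof. by move=> h1 h2; rewrite -(subrKA z) vD_le. Qed.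
Lemma v_dist_lt z x y r : v (x - z) < r -> v (z - y) < r -> v (x - y) < r.
Proof. by move=> h1 h2; rewrite -(subrKA z) vD_lt. Qed.
Lemma v_sum (I : Type) (s : seq I) (P : pred I) (F : I -> K) r :
  0 <= r -> (forall i, P i -> v (F i) <= r) -> v (\sum_(i <- s | P i) F i) <= r.
Proof.
move=> r0 h; elim/big_rec: _ => [|i x Pi hx]; first by rewrite v0.
by apply: vD_le => //; apply: h.
Qed.
Lemma v_prod (I : Type) (s : seq I) (P : pred I) (F : I -> K) :
  v (\prod_(i <- s | P i) F i) = \prod_(i <- s | P i) v (F i).
Proof. by elim/big_rec2: _ => [|i x y Pi <-]; rewrite ?v1 ?vM. Qed.

(** Every triangle is isosceles. *)
Lemma v_eq_of_lt x y : v (x - y) < v y -> v x = v y.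
Proof.
move=> h; apply/eqP; rewrite eq_le; apply/andP; split.
  by rewrite -[x](subrK y); apply: vD_le => //; apply: ltW.
rewrite leNgt; apply/negP => h2.
suff: v y < v y by rewrite ltxx.
by rewrite -{1}[y](subKr x); apply: vB_lt => //; rewrite vBC.
Qed.
Lemma v_unit_of_lt x y : v y = 1 -> v (x - y) < 1 -> v x = 1.
Proof. by move=> hy h; rewrite (@v_eq_of_lt x y) ?hy. Qed.

Lemma vM_le x y r s : v x <= r -> v y <= s -> v (x * y) <= r * s.
Proof. by move=> hx hy; rewrite vM ler_pM. Qed.
Lemma vM_le1 x y : v x <= 1 -> v y <= 1 -> v (x * y) <= 1.
Proof. by move=> hx hy; rewrite -(mulr1 1) vM_le. Qed.
Lemma vX_le1 x n : v x <= 1 -> v (x ^+ n) <= 1.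
Proof. by move=> hx; rewrite vX exprn_ile1. Qed.

Lemma v_nat n : v n%:R <= 1.
Proof. by elim: n => [|n IH]; rewrite ?v0 // -natr1 vD_le ?v1. Qed.
Lemma v_int (z : int) : v z%:~R <= 1.
Proof. by case: z => n; rewrite ?NegzE ?mulrNz ?vN ?v_nat // -pmulrn v_nat. Qed.
Lemma vp : v p%:R = p%:R^-1. Proof. exact: Cp_abs_p Cp. Qed.
Lemma v_pX k : v (p%:R ^+ k) = pabs k. Proof. by rewrite vX vp. Qed.
Lemma p_neq0 : p%:R != 0 :> K.
Proof. by rewrite -[_ == _]negbK; apply/negP=> /negPn/eqP h; have := vp; rewrite h v0 => /esym/eqP; rewrite invr_eq0 gt_eqF ?pR_gt0. Qed.
Lemma v_pmulr k x : v x <= 1 -> v (x *+ p ^ k) <= pabs k.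
Proof. by move=> hx; rewrite -mulr_natr natrX -[pabs k]mul1r vM_le ?v_pX. Qed.

(** From a Bezout relation 1 = u n - w p, in which w p is small. *)
Lemma v_coprime n : coprime p n -> v n%:R = 1.
Proof.
move=> cpn; apply/eqP; rewrite eq_le v_nat /=.
have n0 : (0 < n)%N by case: n cpn => //; rewrite /coprime gcdn0; case: p p_prime => [|[]].
have [km kn e _] := egcdnP p n0.
rewrite gcdnC (eqP cpn) in e.
have e1 : 1 = km%:R * n%:R - kn%:R * p%:R :> K.
  by rewrite -!natrM e natrD addrAC subrr add0r.
have: v (km%:R * n%:R - kn%:R * p%:R) <= Num.max (v n%:R) (v p%:R).
  apply: vB_le; rewrite vM le_max; apply/orP; [left|right];
    by rewrite ler_piMl ?v_nat ?(Cp_abs_ge0 Cp).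
rewrite -e1.
by rewrite v1 le_max vp => /orP[//|]; rewrite leNgt pR_inv_lt1.
Qed.
Lemma v_small_unit n : (0 < n < p)%N -> v n%:R = 1.
Proof.
move=> /andP[n0 np]; apply: v_coprime; rewrite prime_coprime //.
by apply/negP => /(dvdn_leq n0); rewrite leqNgt np.
Qed.
Lemma v_nat_lt1 n : v n%:R < 1 -> (p %| n)%N.
Proof. by apply: contraLR; rewrite -prime_coprime // => /v_coprime ->; rewrite ltxx. Qed.

Lemma v_nat_dvd k n : v n%:R <= pabs k -> (p ^ k %| n)%N.
Proof.
elim: k n => [|k IH] n hn; first by rewrite dvd1n.
have /dvdnP[m em] : (p %| n)%N.
  by apply: v_nat_lt1; apply: le_lt_trans hn _; rewrite -pabs0 pabs_lt.
rewrite em expnSr dvdn_pmul2r ?prime_gt0 //; apply: IH.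
move: hn; rewrite em natrM vM vp -addn1 pabsD pabs1 ler_pM2r // invr_gt0 pR_gt0 //.
Qed.
(** A natural number that vanishes in the field is divisible by all p ^ k. *)
Lemma natK_neq0 n : (0 < n)%N -> n%:R != 0 :> K.
Proof.
move=> n0; apply/negP => /eqP nz.
have /v_nat_dvd : v n%:R <= pabs n by rewrite nz v0 ltW ?pabs_gt0.
by move=> /(dvdn_leq n0); rewrite leqNgt ltn_expl ?prime_gt1.
Qed.
Lemma v_natB_dvd k m n : (n <= m)%N -> v (m%:R - n%:R) <= pabs k -> (p ^ k %| m - n)%N.
Proof. by move=> nm h; apply: v_nat_dvd; rewrite natrB. Qed.

Lemma v_div_unit x y : v y = 1 -> v (x / y) = v x.
Proof. by move=> hy; rewrite vM vV hy invr1 mulr1. Qed.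

Lemma v_inv_dist x y : v x = 1 -> v y = 1 -> v (x^-1 - y^-1) = v (x - y).
Proof.
move=> hx hy; have x0 := v_neq0_of hx; have y0 := v_neq0_of hy.
have -> : x^-1 - y^-1 = (y - x) / (x * y) by field; rewrite x0 y0.
by rewrite v_div_unit ?vM ?hx ?hy ?mulr1 // vBC.
Qed.

(** Stability of products under perturbation: x y - x' y' = x (y - y') + (x -
    x') y'. *)
Lemma vM_dist x x' y y' r s t : v x <= s -> v y' <= t -> 0 <= r ->
   v (y - y') * s <= r -> v (x - x') * t <= r -> v (x * y - x' * y') <= r.
Proof.
move=> hx hy r0 h1 h2.
have -> : x * y - x' * y' = x * (y - y') + (x - x') * y' by ring.
apply: vD_le.
  by apply: le_trans h1; rewrite vM mulrC ler_wpM2l.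
by apply: le_trans h2; rewrite vM ler_wpM2l.
Qed.

Lemma vlim_uniq u l l' : vlim v u l -> vlim v u l' -> l = l'.
Proof.
move=> h h'; apply/eqP; rewrite -subr_eq0; apply/negP => /negP nz.
have d0 := v_gt0 nz.
have [N hN] := h _ d0; have [N' hN'] := h' _ d0.
suff: v (l - l') < v (l - l') by rewrite ltxx.
apply: (@v_dist_lt (u (maxn N N'))); first by rewrite vBC hN ?leq_maxl.
by apply: hN'; rewrite leq_maxr.
Qed.

Lemma vlim_cst c : vlim v (fun=> c) c.
Proof. by move=> e e0; exists 0%N => n _; rewrite subrr v0. Qed.

Lemma vlim_rate u l : (forall n, v (u n - l) <= pabs n) -> vlim v u l.
Proof.
move=> h e e0; have [k hk] := pabs_small e0; exists k => n kn.
by apply: le_lt_trans (h n) _; apply: le_lt_trans hk; apply: pabs_le.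
Qed.

Lemma vlimD u w l l' : vlim v u l -> vlim v w l' -> vlim v (fun n => u n + w n) (l + l').
Proof.
move=> h h' e e0; have [N hN] := h e e0; have [N' hN'] := h' e e0.
exists (maxn N N') => n; rewrite geq_max => /andP[n1 n2].
by rewrite opprD addrACA vD_lt ?hN ?hN'.
Qed.

Lemma vlim_bound u l r : vlim v u l -> (forall n, v (u n) <= r) -> v l <= r.
Proof.
move=> h hu; rewrite leNgt; apply/negP => lt.
have r0 : 0 <= r by apply: le_trans (hu 0%N).
have l0 : 0 < v l by apply: le_lt_trans lt.
have [N /(_ N (leqnn N)) hN] := h _ l0.
by have := hu N; rewrite (v_eq_of_lt hN) leNgt lt.
Qed.

Lemma vlim_unit u l : vlim v u l -> (forall n, v (u n) = 1) -> v l = 1.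
Proof.
move=> h hu; have [N /(_ N (leqnn N)) hN] := h 1 ltr01.
by apply: v_unit_of_lt (hu N) _; rewrite vBC.
Qed.

Lemma vlimM u w l l' : vlim v u l -> vlim v w l' -> vlim v (fun n => u n * w n) (l * l').
Proof.
move=> h h' e e0.
pose B := Num.max 1 (Num.max (v l) (v l')).
have B0 : 0 < B by rewrite lt_max ltr01.
have [N hN] := h _ (divr_gt0 e0 B0).
have [N' hN'] := h' _ (divr_gt0 e0 B0).
have [N2 hN2] := h' 1 ltr01.
exists (maxn N (maxn N' N2)) => n; rewrite !geq_max => /and3P[n1 n2 n3].
have -> : u n * w n - l * l' = (u n - l) * w n + l * (w n - l') by ring.
have wB : v (w n) <= B.
  rewrite -[w n](subrK l'); apply: vD_le; last by rewrite /B !le_max lexx !orbT.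
  by rewrite /B le_max ltW ?hN2.
have lB : v l <= B by rewrite /B !le_max lexx orbT.
apply: vD_lt; rewrite vM.
  apply: le_lt_trans (ler_wpM2l (v_ge0 _) wB) _.
  by rewrite -ltr_pdivlMr // hN.
apply: le_lt_trans (ler_wpM2r (v_ge0 _) lB) _.
by rewrite mulrC -ltr_pdivlMr // hN'.
Qed.

Lemma vlimV u l : l != 0 -> vlim v u l -> vlim v (fun n => (u n)^-1) l^-1.
Proof.
move=> l0 h e e0; have vl0 := v_gt0 l0.
have [N hN] := h _ vl0.
have [N' hN'] := h _ (mulr_gt0 e0 (mulr_gt0 vl0 vl0)).
exists (maxn N N') => n; rewrite geq_max => /andP[n1 n2].
have e1 : v (u n) = v l by apply: v_eq_of_lt (hN _ n1).
have u0 : u n != 0 by apply: contraTneq vl0 => un0; rewrite -e1 un0 v0 ltxx.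
have -> : (u n)^-1 - l^-1 = (l - u n) / (u n * l) by field; rewrite u0 l0.
rewrite vM vV vM e1 ltr_pdivrMr ?mulr_gt0 // vBC.
exact: hN'.
Qed.

Lemma vlim_prod (I : Type) (s : seq I) (u : I -> nat -> K) (l : I -> K) :
  (forall i, vlim v (u i) (l i)) ->
  vlim v (fun n => \prod_(i <- s) u i n) (\prod_(i <- s) l i).
Proof.
move=> h; elim: s => [|i s IH].
  by rewrite big_nil => e e0; exists 0%N => n _; rewrite big_nil subrr v0.
rewrite big_cons => e e0; have [N hN] := vlimM (h i) IH e0.
by exists N => n hn; rewrite big_cons; apply: hN.
Qed.

Lemma v_steps u : (forall n, v (u n.+1 - u n) <= pabs n) ->
  forall n k, v (u (n + k)%N - u n) <= pabs n.
Proof.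
move=> h n; elim=> [|k IH]; first by rewrite addn0 subrr v0 ltW ?pabs_gt0.
apply: (@v_dist_le (u (n + k)%N)) => //.
by rewrite addnS; apply: le_trans (h _) _; rewrite pabs_le ?leq_addr.
Qed.

(** A limit of the sequence, 0 by default if it diverges. *)
Definition vlimit (u : nat -> K) : K := xget 0 [set l | vlim v u l].

Lemma vlimitP u : (forall n, v (u n.+1 - u n) <= pabs n) ->
  vlim v u (vlimit u) /\ forall n, v (u n - vlimit u) <= pabs n.
Proof.
move=> h; have st := v_steps h.
have hl : vlim v u (vlimit u).
  apply: xgetPex; apply: (Cp_complete Cp) => e e0.
  have [k hk] := pabs_small e0; exists k => m n km kn.
  apply: le_lt_trans hk; apply: (@v_dist_le (u k)).
    by rewrite -(subnKC km).
  by rewrite vBC -(subnKC kn).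
split=> // n; rewrite leNgt; apply/negP => lt.
have [N hN] := hl _ (lt_trans (pabs_gt0 n) lt).
suff: v (u n - vlimit u) < v (u n - vlimit u) by rewrite ltxx.
apply: (@v_dist_lt (u (n + N)%N)); last by rewrite hN ?leq_addl.
by rewrite vBC; apply: le_lt_trans (st _ _) lt.
Qed.

Lemma vlim_unif (u : nat -> nat -> K) (l : nat -> K) n (e : R) :
  (forall i, vlim v (u i) (l i)) -> 0 < e ->
  exists N, forall s, (N <= s)%N -> forall i, (i < n)%N -> v (u i s - l i) < e.
Proof.
move=> h e0; elim: n => [|n [N hN]]; first by exists 0%N.
have [N' hN'] := h n e e0; exists (maxn N N') => s.
rewrite geq_max => /andP[n1 n2] i; rewrite ltnS leq_eqVlt => /predU1P[->|]; last exact: hN.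
exact: hN'.
Qed.

Definition ev (x : K) (P : {poly int}) : K := (map_poly intr P).[x].

Lemma ev0 x : ev x 0 = 0. Proof. by rewrite /ev rmorph0 horner0. Qed.
Lemma ev1 x : ev x 1 = 1. Proof. by rewrite /ev rmorph1 hornerC. Qed.
Lemma evD x P Q : ev x (P + Q) = ev x P + ev x Q.
Proof. by rewrite /ev rmorphD hornerD. Qed.
Lemma evB x P Q : ev x (P - Q) = ev x P - ev x Q.
Proof. by rewrite /ev rmorphB hornerD hornerN. Qed.
Lemma evM x P Q : ev x (P * Q) = ev x P * ev x Q.
Proof. by rewrite /ev rmorphM hornerM. Qed.
Lemma evMn x P n : ev x (P *+ n) = ev x P *+ n.
Proof. by rewrite /ev rmorphMn hornerMn. Qed.
Lemma ev_sum x (I : Type) (s : seq I) (F : I -> {poly int}) :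
  ev x (\sum_(i <- s) F i) = \sum_(i <- s) ev x (F i).
Proof. by elim/big_rec2: _ => [|i P y _ <-]; rewrite ?ev0 ?evD. Qed.
Lemma ev_prod x (I : Type) (s : seq I) (B : pred I) (F : I -> {poly int}) :
  ev x (\prod_(i <- s | B i) F i) = \prod_(i <- s | B i) ev x (F i).
Proof. by elim/big_rec2: _ => [|i P y _ <-]; rewrite ?ev1 ?evM. Qed.
Lemma evX x P n : ev x (P ^+ n) = ev x P ^+ n.
Proof. by rewrite /ev rmorphXn horner_exp. Qed.
Lemma ev_comp x n P : ev x (P \Po 'X^n) = ev (x ^+ n) P.
Proof. by rewrite /ev map_comp_poly map_polyXn horner_comp hornerXn. Qed.

Lemma v_ev x P : v x <= 1 -> v (ev x P) <= 1.
Proof.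
move=> hx; elim/poly_ind: P => [|P c IH]; first by rewrite ev0 v0.
rewrite /ev rmorphD rmorphM /= map_polyX map_polyC /= hornerMXaddC.
by apply: vD_le; rewrite ?v_int ?vM_le1.
Qed.

(** An integral polynomial is 1-Lipschitz on the closed unit disk; this is
    what makes its reduction modulo p a function on residue classes. *)
Lemma ev_dist x y P : v x <= 1 -> v y <= 1 -> v (ev x P - ev y P) <= v (x - y).
Proof.
move=> hx hy; elim/poly_ind: P => [|P c IH]; first by rewrite !ev0 subrr v0.
rewrite /ev rmorphD rmorphM /= map_polyX map_polyC /= !hornerMXaddC.
have -> : forall s t c : K, s * x + c - (t * y + c) = s * (x - y) + (s - t) * y.
  by move=> *; ring.
apply: vD_le; rewrite vM.
  by rewrite ler_piMl // v_ev.
by apply: le_trans IH; rewrite ler_piMr.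
Qed.
End Valued.

(** * Divisibility by powers of p and Frobenius lifts *)

Section PDvd.
Variables (p : nat) (p_prime : prime p) (A : comNzRingType).
Implicit Types x y z : A.

(** Divisibility by p ^ k in an arbitrary commutative ring, such as
    polynomials with integral coefficients in one or two variables. *)
Definition pdvd (k : nat) (x : A) : Prop := exists z, x = z *+ p ^ k.

Lemma pdvd0 k : pdvd k 0. Proof. by exists 0; rewrite mul0rn. Qed.
Lemma pdvd_exp0 x : pdvd 0 x. Proof. by exists x. Qed.
Lemma pdvdD k x y : pdvd k x -> pdvd k y -> pdvd k (x + y).
Proof. by move=> [a ->] [b ->]; exists (a + b); rewrite mulrnDl. Qed.
Lemma pdvdN k x : pdvd k x -> pdvd k (- x).
Proof. by move=> [a ->]; exists (- a); rewrite mulNrn. Qed.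
Lemma pdvdM j k x y : pdvd j x -> pdvd k y -> pdvd (j + k) (x * y).
Proof.
by move=> [a ->] [b ->]; exists (a * b); rewrite mulrnAl mulrnAr -mulrnA expnD mulnC.
Qed.
Lemma pdvdMl k x y : pdvd k y -> pdvd k (x * y).
Proof. exact: (@pdvdM 0 k x y (pdvd_exp0 x)). Qed.
Lemma pdvdMr k x y : pdvd k x -> pdvd k (x * y).
Proof. by rewrite mulrC; apply: pdvdMl. Qed.
Lemma pdvdW j k x : (j <= k)%N -> pdvd k x -> pdvd j x.
Proof.
move=> jk [a ->]; exists (a *+ p ^ (k - j)).
by rewrite -mulrnA -expnD subnK.
Qed.
Lemma pdvd_sum (I : Type) (s : seq I) (P : pred I) (F : I -> A) k :
  (forall i, P i -> pdvd k (F i)) -> pdvd k (\sum_(i <- s | P i) F i).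
Proof.
move=> h; elim/big_rec: _ => [|i x Pi hx]; first exact: pdvd0.
by apply: pdvdD => //; apply: h.
Qed.
Lemma pdvd_trans k y x z : pdvd k (x - y) -> pdvd k (y - z) -> pdvd k (x - z).
Proof. by move=> h1 h2; rewrite -(subrKA y); apply: pdvdD. Qed.
Lemma pdvdX k x y n : pdvd k (x - y) -> pdvd k (x ^+ n - y ^+ n).
Proof. by move=> h; rewrite subrXX; apply: pdvdMr. Qed.

Lemma frobD x y : pdvd 1 ((x + y) ^+ p - (x ^+ p + y ^+ p)).
Proof.
move: (prednK (prime_gt0 p_prime)); move: p.-1 => q pE.
have pr_q : prime q.+1 by rewrite pE.
rewrite -pE exprDn.
rewrite big_ord_recl big_ord_recr /= bin0 binn subn0 subnn !expr0 mul1r mulr1 !mulr1n.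
have e (a b c : A) : a + (b + c) - (a + c) = b by ring.
rewrite e; apply: pdvd_sum => i _.
have : (q.+1 %| 'C(q.+1, bump 0 i))%N.
  by apply: prime_dvd_bin => //; rewrite /bump /= add1n ltnS ltn_ord.
move=> /dvdnP[m ->]; exists (x ^+ (q.+1 - bump 0 i) * y ^+ bump 0 i *+ m).
by rewrite -mulrnA pE expn1.
Qed.

Lemma frobDX m x y : pdvd 1 ((x + y) ^+ (p ^ m) - (x ^+ (p ^ m) + y ^+ (p ^ m))).
Proof.
elim: m => [|m IH]; first by rewrite !expr1 subrr; apply: pdvd0.
rewrite expnSr !exprM.
exact: pdvd_trans (pdvdX p IH) (frobD _ _).
Qed.

(** x ^ p - y ^ p is (x - y) times a sum of p terms, all congruent to y ^ (p -
    1) modulo p; so one more factor p appears. *)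
Lemma pdvd_lift k x y : pdvd k.+1 (x - y) -> pdvd k.+2 (x ^+ p - y ^+ p).
Proof.
move=> h; rewrite subrXX -(addn1 k.+1); apply: pdvdM => //.
have -> : \sum_(i < p) x ^+ (p.-1 - i) * y ^+ i
  = \sum_(i < p) (x ^+ (p.-1 - i) - y ^+ (p.-1 - i)) * y ^+ i + y ^+ p.-1 *+ p.
  rewrite -[X in y ^+ p.-1 *+ X]card_ord -sumr_const -big_split /=.
  apply: eq_bigr => i _; rewrite mulrBl -exprD subnK ?subrK //.
  by rewrite -ltnS prednK ?prime_gt0.
apply: pdvdD; last by exists (y ^+ p.-1); rewrite expn1.
by apply: pdvd_sum => i _; apply: pdvdMr; apply: pdvdX; apply: pdvdW h.
Qed.

Lemma pdvd_liftX k x y : pdvd 1 (x - y) -> pdvd k.+1 (x ^+ (p ^ k) - y ^+ (p ^ k)).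
Proof.
move=> h; elim: k => [|k IH]; first by rewrite !expr1.
by rewrite expnSr !exprM; apply: pdvd_lift.
Qed.
End PDvd.

Section FrobPoly.
Variables (p : nat) (p_prime : prime p).

(** A lift f of the p ^ m-power Frobenius to A extends to A[X] by X |-> X ^ (p
    ^ m). *)
Lemma frob_poly (A : comNzRingType) (f : {rmorphism A -> A}) m :
  (forall a : A, pdvd p 1 (a ^+ (p ^ m) - f a)) ->
  forall Y : {poly A}, pdvd p 1 (Y ^+ (p ^ m) - (map_poly f Y \Po 'X^(p ^ m))).
Proof.
move=> hf; elim/poly_ind => [|Y c IH].
  have q0 : (0 < p ^ m)%N by rewrite expn_gt0 prime_gt0.
  rewrite rmorph0 comp_poly0 subr0 expr0n (gtn_eqF q0).
  exact: pdvd0.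
rewrite rmorphD rmorphM /= map_polyX map_polyC /= comp_poly_MXaddC.
apply: (pdvd_trans (frobDX p_prime m _ _)).
have -> : forall a b c d : {poly A}, (a + b) - (c + d) = (a - c) + (b - d).
  by move=> *; ring.
apply: pdvdD.
  by rewrite exprMn -mulrBl; apply: pdvdMr.
have [a ha] := hf c; rewrite -polyC_exp -polyCB ha.
by exists a%:P; rewrite polyCMn.
Qed.

Lemma frob_int m (z : int) : pdvd p 1 (z ^+ (p ^ m) - z).
Proof.
have q0 : (0 < p ^ m)%N by rewrite expn_gt0 prime_gt0.
have step (x y : int) : pdvd p 1 (x ^+ (p ^ m) - x) -> pdvd p 1 (y ^+ (p ^ m) - y) ->
    pdvd p 1 ((x + y) ^+ (p ^ m) - (x + y)).
  move=> hx hy; apply: (pdvd_trans (frobDX p_prime m _ _)).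
  by rewrite opprD addrACA; apply: pdvdD.
have h1 : pdvd p 1 ((1 : int) ^+ (p ^ m) - 1) by rewrite expr1n subrr; apply: pdvd0.
have hN1 : pdvd p 1 ((-1 : int) ^+ (p ^ m) - (-1)).
  have := frobDX p_prime m (-1 : int) 1.
  rewrite addNr expr0n gtn_eqF //= => h.
  have /pdvdN := h; rewrite sub0r expr1n opprK; by rewrite opprK.
elim: z => [|n IH|n IH].
- by rewrite expr0n gtn_eqF //= subrr; apply: pdvd0.
- by rewrite -(addn1 n) PoszD; apply: step.
- by rewrite -(addn1 n) PoszD opprD; apply: step.
Qed.

(** The m-th power of the Frobenius lift of Z[lambda], lambda |-> lambda ^ p.
    *)
Definition twist m (P : {poly int}) : {poly int} := P \Po 'X^(p ^ m).
(** The m-th power of the Frobenius lift of Z[lambda][t] that raises both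
    lambda and t to the power p. *)
Definition twist2 m (Y : {poly {poly int}}) : {poly {poly int}} :=
  map_poly (comp_poly 'X^(p ^ m)) Y \Po 'X^(p ^ m).

Lemma frob_twist m P : pdvd p 1 (P ^+ (p ^ m) - twist m P).
Proof.
have := @frob_poly int idfun m (frob_int m) P.
by rewrite map_poly_id.
Qed.
Lemma frob_twist2 m Y : pdvd p 1 (Y ^+ (p ^ m) - twist2 m Y).
Proof. exact: frob_poly (frob_twist m) Y. Qed.

Lemma twist2M m X Y : twist2 m (X * Y) = twist2 m X * twist2 m Y.
Proof. by rewrite /twist2 rmorphM /= comp_polyM. Qed.
Lemma twist2_1 m : twist2 m 1 = 1.
Proof. by rewrite /twist2 rmorph1 comp_polyC. Qed.
Lemma twist2X m X n : twist2 m (X ^+ n) = twist2 m X ^+ n.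
Proof. by elim: n => [|n IH]; rewrite ?twist2_1 // !exprS twist2M IH. Qed.

Lemma size_twist2 m Y : (size (twist2 m Y) <= ((size Y).-1 * p ^ m).+1)%N.
Proof.
apply: leq_trans (size_comp_poly_leq _ _) _.
rewrite size_polyXn ltnS leq_mul2r; apply/orP; right.
by rewrite -!subn1 leq_sub2r ?size_poly.
Qed.

(** Exponents below p ^ m have a unique expansion: in X(t) Y(t ^ (p ^ m)) the
    monomial t ^ (t0 + p ^ m u) with t0 < p ^ m can only come from t ^ t0 in X
    and t ^ u in Y. *)
Lemma coef_decouple m (X Y : {poly {poly int}}) t u :
  (size X <= p ^ m)%N -> (t < p ^ m)%N ->
  (X * twist2 m Y)`_(t + p ^ m * u) = X`_t * twist m Y`_u.
Proof.
move=> sX tm; have q0 : (0 < p ^ m)%N by rewrite expn_gt0 prime_gt0.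
rewrite coefM.
have lt_t : (t < (t + p ^ m * u).+1)%N by rewrite ltnS leq_addr.
rewrite (bigD1 (Ordinal lt_t)) //= [X in _ + X]big1 => [|j /eqP jt]; last first.
  have [jm|mj] := ltnP j (p ^ m); last first.
    by rewrite nth_default ?mul0r // (leq_trans sX).
  rewrite [X in _ * X](_ : _ = 0) ?mulr0 //.
  rewrite /twist2 coef_comp_poly_Xn // ifN //.
  apply/negP => d; apply: jt; apply: val_inj => /=.
  have jl : (j <= t + p ^ m * u)%N by rewrite -ltnS ltn_ord.
  have := d; rewrite -(eqn_mod_dvd _ jl) => /eqP.
  by rewrite [in LHS]addnC [in LHS]mulnC modnMDl !modn_small.
rewrite addr0 addKn /twist2 coef_comp_poly_Xn // dvdn_mulr // mulKn // coef_map //.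
Qed.
End FrobPoly.

(** * Dwork congruences for coefficients of digit products *)

Section Dwork.
Variables (p : nat) (R : realType) (K : closedFieldType) (v : K -> R).
Hypotheses (p_prime : prime p) (Cp : is_Cp p v).
Variables (G : nat -> {poly {poly int}}) (be : nat -> nat).
Hypothesis size_G : forall i, (size (G i) <= p)%N.
Hypothesis be_lt : forall i, (be i < p)%N.

Local Notation pabs := (pabs p R).

(** The number whose base p digits are d k, d (k + 1), ..., d (k + n - 1),
    lowest first. *)
Definition digsum (d : nat -> nat) (k n : nat) : nat := (\sum_(j < n) d (k + j)%N * p ^ j)%N.

Lemma digsumS d k n : digsum d k n.+1 = (digsum d k n + d (k + n)%N * p ^ n)%N.
Proof. by rewrite /digsum big_ord_recr. Qed.
Lemma digsum0 d k : digsum d k 0 = 0%N.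
Proof. by rewrite /digsum big_ord0. Qed.
Lemma digsum1 d k : digsum d k 1 = d k.
Proof. by rewrite /digsum big_ord_recr big_ord0 /= addn0 muln1. Qed.
Lemma digsumD d k j n : digsum d k (j + n) = (digsum d k j + p ^ j * digsum d (k + j) n)%N.
Proof.
elim: n => [|n IH]; first by rewrite addn0 digsum0 muln0 addn0.
by rewrite addnS !digsumS IH mulnDr addnA expnD addnA; congr (_ + _)%N; rewrite mulnCA.
Qed.
Lemma digsum_lt d k n : (forall i, d i < p)%N -> (digsum d k n < p ^ n)%N.
Proof.
move=> dp; elim: n => [|n IH]; first by rewrite digsum0.
rewrite digsumS; apply: (@leq_trans (p ^ n + d (k + n)%N * p ^ n)%N); first by rewrite ltn_add2r.
by rewrite -mulSn expnS leq_mul2r dp orbT.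
Qed.

(** With the exponents p ^ j, this product has degree below p ^ n, like a
    number with n digits. *)
Definition Gprod (k n : nat) : {poly {poly int}} := \prod_(j < n) G (k + j)%N ^+ (p ^ j).

Lemma GprodS k n : Gprod k n.+1 = Gprod k n * G (k + n)%N ^+ (p ^ n).
Proof. by rewrite /Gprod big_ord_recr. Qed.
Lemma Gprod0 k : Gprod k 0 = 1.
Proof. by rewrite /Gprod big_ord0. Qed.
Lemma Gprod1 k : Gprod k 1 = G k.
Proof. by rewrite GprodS Gprod0 mul1r addn0 expr1. Qed.
Lemma GprodD k j n : Gprod k (j + n) = Gprod k j * Gprod (k + j) n ^+ (p ^ j).
Proof.
elim: n => [|n IH]; first by rewrite addn0 Gprod0 expr1n mulr1.
by rewrite addnS !GprodS IH exprMn -exprM mulrA addnA -expnD (addnC n).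
Qed.

Lemma size_mulX m j (X Y Z : {poly {poly int}}) :
  (size X <= p ^ m)%N -> (size Y <= p ^ j)%N -> (size Z <= ((size Y).-1 * p ^ m).+1)%N ->
  (size (X * Z)%R <= p ^ (m + j))%N.
Proof.
move=> sX sY sZ; have q0 i : (0 < p ^ i)%N by rewrite expn_gt0 prime_gt0.
apply: leq_trans (size_polyMleq _ _) _.
apply: (@leq_trans (p ^ m + ((p ^ j).-1 * p ^ m).+1).-1).
  rewrite -!subn1 leq_sub2r // leq_add // (leq_trans sZ) // ltnS leq_mul2r.
  by apply/orP; right; rewrite -!subn1 leq_sub2r.
by rewrite addnS /= -mulSn prednK // expnD mulnC.
Qed.

Lemma size_Gprod k n : (size (Gprod k n) <= p ^ n)%N.
Proof.
elim: n => [|n IH]; first by rewrite Gprod0 size_poly1.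
rewrite GprodS -addn1; apply: (@size_mulX n 1 _ (G (k + n)%N)) => //.
exact: size_poly_exp_leq.
Qed.

(** The coefficient of [Gprod] at the exponent whose digits are the [be]: the
    analogue, for the digits of indices k, ..., k + n - 1, of the constant
    term of a power of a Laurent polynomial. *)
Definition cpoly (k n : nat) : {poly int} := (Gprod k n)`_(digsum be k n).

(** The Frobenius twist of order m of [cpoly], evaluated at y. *)
Definition cval (y : K) k m n : K := ev (y ^+ (p ^ m)) (cpoly k n).
(** Here X and t stand for the contribution of m digits that precede the
    digits of indices k, ..., k + n - 1 to the product and to the exponent.
    Quantifying over X is what lets the proof of the congruence be an
    induction. *)
Definition wval (y : K) k m (X : {poly {poly int}}) t n : K :=
  ev y (X * Gprod k n ^+ (p ^ m))`_(t + p ^ m * digsum be k n).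

(** X times the ghost term of index j: the first j factors twisted, and the
    difference between the power of the next factor and its twist. It is a
    polynomial of the same kind as X, with j + 1 more digits, but divisible by
    p ^ (j + 1) more. *)
Definition ghost_prefix k m (X : {poly {poly int}}) j :=
  X * (twist2 p m (Gprod k j) *
    (G (k + j)%N ^+ (p ^ (m + j)) - twist2 p m (G (k + j)%N ^+ (p ^ j)))).
(** The exponent that goes with [ghost_prefix]. *)
Definition ghost_target k m t j := (t + p ^ m * digsum be k j.+1)%N.

(** The factors after X are replaced by their twists one at a time. Once all
    are twisted, X decouples from them and leaves the product of its own
    coefficient with [cval]; the replacement of each single factor costs the
    value attached to a ghost term. *)
Lemma wval_telescope y k m (X : {poly {poly int}}) t n : (size X <= p ^ m)%N -> (t < p ^ m)%N ->
  wval y k m X t n = ev y X`_t * cval y k m n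
    + \sum_(j < n) wval y (k + j.+1) (m + j.+1) (ghost_prefix k m X j) (ghost_target k m t j) (n - j.+1).
Proof.
move=> sX tm.
pose V j := (X * (twist2 p m (Gprod k j) * Gprod (k + j) (n - j) ^+ (p ^ (m + j))))`_(t + p ^ m * digsum be k n).
have V0 : wval y k m X t n = ev y (V 0%N).
  by rewrite /wval /V Gprod0 twist2_1 mul1r !addn0 subn0.
have Vn : V n = X`_t * twist p m (cpoly k n).
  by rewrite /V subnn Gprod0 expr1n mulr1 coef_decouple.
have Vj (j : 'I_n) : wval y (k + j.+1) (m + j.+1) (ghost_prefix k m X j) (ghost_target k m t j) (n - j.+1) = ev y (V j - V j.+1).
  rewrite /wval /V /ghost_prefix /ghost_target -coefB.
  have -> : (t + p ^ m * digsum be k j.+1 + p ^ (m + j.+1) * digsum be (k + j.+1) (n - j.+1)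
     = t + p ^ m * digsum be k n)%N.
    by rewrite -addnA expnD -mulnA -mulnDr -digsumD subnKC.
  congr (ev y (polyseq _)`__).
  have -> : (n - j = 1 + (n - j.+1))%N by rewrite add1n subnSK.
  rewrite GprodD Gprod1 GprodS twist2M twist2X.
  rewrite exprMn -exprM -expnD add1n (addn1 (k + j)) addnS (addnS m).
  ring.
rewrite V0 (eq_bigr _ (fun j _ => Vj j)) -ev_sum -(big_mkord xpredT (fun j => V j - V j.+1)).
have -> : \sum_(0 <= j < n) (V j - V j.+1) = V 0%N - V n.
  rewrite -[RHS]opprB -telescope_sumr // -sumrN.
  by apply: eq_bigr => j _; rewrite opprB.
by rewrite evB Vn evM /twist ev_comp addrC subrK.
Qed.

Lemma size_ghost_prefix k m (X : {poly {poly int}}) j : (size X <= p ^ m)%N -> (size (ghost_prefix k m X j) <= p ^ (m + j.+1))%N.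
Proof.
move=> sX; rewrite /ghost_prefix mulrA -addn1 addnA.
apply: (@size_mulX (m + j) 1 _ (G (k + j)%N)); last 1 first.
- apply: leq_trans (size_polyD _ _) _; rewrite geq_max size_poly_exp_leq size_polyN twist2X /=.
  apply: leq_trans (size_poly_exp_leq _ _) _.
  rewrite ltnS expnD mulnA leq_mul2r; apply/orP; right.
  have := size_twist2 p m (G (k + j)%N); by case: (size (twist2 _ _ _)).
- by apply: (@size_mulX m j _ (Gprod k j)) => //; rewrite ?size_Gprod ?size_twist2.
- by rewrite expn1.
Qed.

Lemma ghost_target_lt k m t j : (t < p ^ m)%N -> (ghost_target k m t j < p ^ (m + j.+1))%N.
Proof.
move=> tm; rewrite /ghost_target expnD.
apply: (@leq_trans (p ^ m + p ^ m * digsum be k j.+1)); first by rewrite ltn_add2r.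
by rewrite -mulnS leq_mul2l (digsum_lt _ _ be_lt) orbT.
Qed.

Lemma pdvd_ghost_prefix e k m X j : pdvd p e X -> pdvd p (e + j.+1) (ghost_prefix k m X j).
Proof.
move=> hX; apply: pdvdM => //; apply: pdvdMl.
rewrite twist2X expnD exprM; apply: pdvd_liftX => //.
exact: frob_twist2.
Qed.

Lemma v_wval y k m e X t n : v y <= 1 -> pdvd p e X -> v (wval y k m X t n) <= pabs e.
Proof.
move=> hy [Z ->]; rewrite /wval mulrnAl coefMn evMn.
by apply: v_pmulr => //; apply: (v_ev Cp).
Qed.

(** The condition under which the quotients in the Dwork congruences make
    sense and can be inverted without loss of precision. *)
Definition unit_at (y : K) := forall k m n, v (cval y k m n) = 1.

Lemma cval_shift y k m j n : cval (y ^+ (p ^ m)) k j n = cval y k (m + j) n.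
Proof. by rewrite /cval -exprM -expnD. Qed.
Lemma unit_at_X y m : unit_at y -> unit_at (y ^+ (p ^ m)).
Proof. by move=> h k j n; rewrite cval_shift. Qed.

(** Leading factors of [Gprod] are a possible X. *)
Lemma wval_cval y k m j n : wval (y ^+ (p ^ m)) (k + j) j (Gprod k j) (digsum be k j) n = cval y k m (j + n).
Proof. by rewrite /wval /cval /cpoly GprodD digsumD. Qed.

(** By [wval_telescope], wval / cval is a constant plus a sum over the ghost
    terms of (wval of the ghost term / cval of the later digits) * (cval of
    the later digits / cval). Both factors are quotients of the kind under
    consideration, the second one inverted, with fewer digits left; the
    induction hypothesis bounds the variation of both, and the missing powers
    of p are supplied by the ghost term. *)
Lemma dwork_congr n : forall y k m e (X : {poly {poly int}}) t, v y <= 1 -> unit_at y ->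
  (size X <= p ^ m)%N -> (t < p ^ m)%N -> pdvd p e X ->
  v (wval y k m X t n.+1 / cval y k m n.+1 - wval y k m X t n / cval y k m n) <= pabs (e + n.+1).
Proof.
elim/ltn_ind: n => n IH y k m e X t hy uy sX tm eX.
have cval_neq0 k' m' n' : cval y k' m' n' != 0 by apply: (v_neq0_of Cp); apply: uy.
pose W j n' := wval y (k + j.+1) (m + j.+1) (ghost_prefix k m X j) (ghost_target k m t j) n'.
pose D j n' := cval y (k + j.+1) (m + j.+1) n'.
have D0 j n' : D j n' != 0 by exact: cval_neq0.
have expand n' : wval y k m X t n' / cval y k m n' = ev y X`_t +
    \sum_(j < n') (W j (n' - j.+1)%N / D j (n' - j.+1)%N) * (D j (n' - j.+1)%N / cval y k m n').
  rewrite wval_telescope // mulrDl mulfK // mulr_suml; congr (_ + _).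
  by apply: eq_bigr => j _; rewrite mulrA divfK.
have cancel (a b c d : K) : a + (b + c) - (a + d) = (b - d) + c by ring.
rewrite !expand big_ord_recr /= subnn cancel -sumrB.
apply: (vD_le Cp) => //; last first.
  rewrite (vM Cp) (v_div_unit Cp _ (uy _ _ _)) (v_div_unit Cp _ (uy _ _ _)) [v (D _ _)]uy mulr1.
  by apply: v_wval => //; apply: pdvd_ghost_prefix.
apply: (v_sum Cp) => //; first exact/ltW/pabs_gt0.
move=> j _; move: (nat_of_ord j) (ltn_ord j) => {}j jn.
have [n' nE] : exists n', (n = n' + j.+1)%N by exists (n - j.+1)%N; rewrite subnK.
have -> : (n.+1 - j.+1 = n'.+1)%N by lia.
have -> : (n - j.+1 = n')%N by lia.
have n'n : (n' < n)%N by lia.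
have nE1 : (n = j.+1 + n')%N by lia.
have nE2 : (n.+1 = j.+1 + n'.+1)%N by lia.
have eE : (e + n.+1 = e + j.+1 + n'.+1)%N by lia.
(* The second factor is the inverse of a quotient of the same form, with
   leading factors of the product as prefix. *)
have inv (l : nat) : D j l / cval y k m (j.+1 + l)
   = (wval (y ^+ (p ^ m)) (k + j.+1) j.+1 (Gprod k j.+1) (digsum be k j.+1) l
       / cval (y ^+ (p ^ m)) (k + j.+1) j.+1 l)^-1.
  by rewrite wval_cval cval_shift invf_div.
have uWC l : v (wval (y ^+ (p ^ m)) (k + j.+1) j.+1 (Gprod k j.+1) (digsum be k j.+1) l
       / cval (y ^+ (p ^ m)) (k + j.+1) j.+1 l) = 1.
  by rewrite wval_cval cval_shift (v_div_unit Cp) ?uy.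
rewrite nE2 [in X in _ - X]nE1 !inv.
apply: (@vM_dist _ _ _ _ Cp _ _ _ _ _ (pabs (e + j.+1)) 1) => //.
- rewrite (v_div_unit Cp) // ?[v (D _ _)]uy //.
  by apply: v_wval => //; apply: pdvd_ghost_prefix.
- by rewrite (vV Cp) // uWC invr1.
- exact/ltW/pabs_gt0.
- rewrite -nE2 eE [in leRHS]pabsD mulrC ler_pM2l ?pabs_gt0 // (v_inv_dist Cp) ?uWC //.
  rewrite -[n'.+1]add0n; apply: IH => //.
  + exact: (vX_le1 Cp).
  + exact: unit_at_X.
  + exact: size_Gprod.
  + exact: digsum_lt.
  + exact: pdvd_exp0.
- rewrite mulr1 -nE2 eE; apply: IH => //.
  + exact: size_ghost_prefix.
  + exact: ghost_target_lt.
  + exact: pdvd_ghost_prefix.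
Qed.

(** Modulo p only the constant term of [wval_telescope] survives, so that
    [cval] is congruent to a product of one coefficient for each digit. *)
Lemma unit_atP y : v y <= 1 ->
  (forall k m, v (ev (y ^+ (p ^ m)) (G k)`_(be k)) = 1) -> unit_at y.
Proof.
move=> hy hG k m n; elim: n k m => [|n IH] k m.
  by rewrite /cval /cpoly Gprod0 digsum0 coef1 ev1 (v1 Cp).
have hz : v (y ^+ (p ^ m)) <= 1 by apply: (vX_le1 Cp).
have sG1 : (size (Gprod k 1) <= p ^ 1)%N by rewrite size_Gprod.
have be1 : (digsum be k 1 < p ^ 1)%N by rewrite digsum_lt.
rewrite -add1n -wval_cval wval_telescope //.
have e1 : v (ev (y ^+ (p ^ m)) (Gprod k 1)`_(digsum be k 1) * cval (y ^+ (p ^ m)) (k + 1) 1 n) = 1.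
  by rewrite Gprod1 digsum1 (vM Cp) // hG cval_shift IH mulr1.
apply: (v_unit_of_lt Cp e1); rewrite addrAC subrr add0r.
apply: (@le_lt_trans _ _ (pabs 1)); last by rewrite -(pabs0 p R) pabs_lt.
apply: (v_sum Cp) => //; first exact/ltW/pabs_gt0.
move=> j _; apply: v_wval => //.
apply: (@pdvdW _ _ _ (0 + j.+1)) => //; apply: pdvd_ghost_prefix; exact: pdvd_exp0.
Qed.

(** The prefix is the first factor of the product. *)
Theorem dwork_ratio y n : v y <= 1 -> unit_at y ->
  v (cval y 0 0 n.+2 / cval y 1 1 n.+1 - cval y 0 0 n.+1 / cval y 1 1 n) <= pabs n.+1.
Proof.
move=> hy uy.
have E l : cval y 0 0 l.+1 = wval y 1 1 (Gprod 0 1) (digsum be 0 1) l.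
  by have := wval_cval y 0 0 1 l; rewrite expn0 expr1 => ->.
rewrite !E; have := @dwork_congr n y 1 1 0 (Gprod 0 1) (digsum be 0 1) hy uy.
rewrite add0n; apply.
- by rewrite size_Gprod.
- by rewrite digsum_lt.
- exact: pdvd_exp0.
Qed.
End Dwork.

(** * Analytic elements and their uniqueness *)

Section Analytic.
Variables (p : nat) (R : realType) (K : closedFieldType) (v : K -> R).
Hypotheses (p_prime : prime p) (Cp : is_Cp p v).
Local Notation pabs := (pabs p R).
Let v_ge0 := Cp_abs_ge0 Cp.

Lemma horner_factor (P : {poly K}) : exists r : seq K,
  forall x, P.[x] = lead_coef P * \prod_(z <- r) (x - z).
Proof.
have [r eP] := closed_field_poly_normal P.
exists r => x; rewrite {1}eP hornerZ.
by rewrite horner_prod; congr (_ * _); apply: eq_bigr => z _; rewrite !hornerE.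
Qed.

Lemma horner_factor_root (P : {poly K}) (r : seq K) z :
  (forall x, P.[x] = lead_coef P * \prod_(z <- r) (x - z)) -> z \in r -> P.[z] = 0.
Proof.
move=> -> zr; rewrite (_ : \prod_(_ <- _) _ = 0) ?mulr0 //.
by apply/eqP; rewrite prodf_seq_eq0; apply/hasP; exists z => //=; rewrite subrr.
Qed.

Lemma v_sub_far x z : v x < v z -> v (x - z) = v z.
Proof.
move=> h; rewrite (vBC Cp); apply: (v_eq_of_lt Cp).
by rewrite addrAC subrr add0r (vN Cp).
Qed.

(** The Gauss norm of P, the largest absolute value of a coefficient, computed
    from the list r of the roots of P. *)
Definition gauss_norm (P : {poly K}) (r : seq K) : R :=
  v (lead_coef P) * \prod_(z <- r) Num.max 1 (v z).

Section Factored.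
Variables (P : {poly K}) (r : seq K).
Hypothesis Pr : forall x, P.[x] = lead_coef P * \prod_(z <- r) (x - z).

Lemma horner_le_gauss x : v x <= 1 -> v P.[x] <= gauss_norm P r.
Proof.
move=> hx; rewrite Pr (vM Cp) (v_prod Cp) ler_wpM2l //.
apply: ler_prod => z _; rewrite v_ge0 /=.
by apply: (vB_le Cp); rewrite le_max ?hx // lexx orbT.
Qed.

(** A root outside the closed unit disk is at distance equal to its absolute
    value from x; the roots inside are at distance 1. *)
Lemma horner_eq_gauss x : v x <= 1 ->
  (forall z, z \in r -> v z <= 1 -> v (x - z) = 1) -> v P.[x] = gauss_norm P r.
Proof.
move=> hx h; rewrite Pr (vM Cp) (v_prod Cp); congr (_ * _).
apply: eq_big_seq => z zr; have [z1|z1] := leP (v z) 1.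
  by rewrite h // max_l.
by rewrite v_sub_far ?max_r ?ltW // (le_lt_trans hx).
Qed.

(** The open disk around 0 sees the Gauss norm: take |x| < 1 so close to 1
    that it exceeds the absolute values of all the roots in the open disk. An
    m-th root of p will do if m is large, in particular larger than the number
    of roots; then the loss is at most a factor |x| ^ m = |p|. *)
Lemma horner_ge_gauss : exists2 x, v x < 1 & pabs 1 * gauss_norm P r <= v P.[x].
Proof.
have [m [mr mz]] : exists m : nat, (size r <= m)%N /\
    (forall z, z \in r -> v z < 1 -> v z ^+ m.+1 < pabs 1).
  suff [m hm] : exists m : nat, forall z, z \in r -> v z < 1 -> v z ^+ m.+1 < pabs 1.
    exists (maxn (size r) m); split; first exact: leq_maxl.
    move=> z zr z1; apply: le_lt_trans (hm z zr z1).
    by apply: ler_wiXn2l; rewrite ?ltnS ?leq_maxr // ltW.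
  elim: r => [|z s [m hm]]; first by exists 0%N.
  have [z1|z1] := ltP (v z) 1; last first.
    exists m => y; rewrite inE => /predU1P[->|]; last exact: hm.
    by move=> /(le_lt_trans z1); rewrite ltxx.
  have [m' hm'] : exists m' : nat, v z ^+ m'.+1 < pabs 1.
    have [k hk] := geom_small (v_ge0 z) z1 (pabs_gt0 R p_prime 1).
    by exists k; apply: hk.
  exists (maxn m m') => y; rewrite inE => /predU1P[->|ys] y1.
    by apply: le_lt_trans hm'; apply: ler_wiXn2l; rewrite ?ltnS ?leq_maxr // ltW.
  by apply: le_lt_trans (hm y ys y1); apply: ler_wiXn2l; rewrite ?ltnS ?leq_maxl // ltW.
have [x xm] : exists x : K, x ^+ m.+1 = p%:R.
  have /closed_rootP[x] : size ('X^(m.+1) - p%:R%:P : {poly K}) != 1.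
    by rewrite size_XnsubC.
  by rewrite rootE !hornerE subr_eq0 => /eqP h; exists x.
have vxm : v x ^+ m.+1 = pabs 1 by rewrite -(vX Cp) xm (vp Cp).
have x1 : v x < 1.
  rewrite -(@ltr_pXn2r _ m.+1) ?nnegrE // vxm expr1n.
  by rewrite -(pabs0 p R) pabs_lt.
exists x => //.
rewrite Pr (vM Cp) (v_prod Cp) mulrCA ler_wpM2l //.
have : v x ^+ (size r) * \prod_(z <- r) Num.max 1 (v z) <= \prod_(z <- r) v (x - z).
  have : forall z, z \in r -> v x * Num.max 1 (v z) <= v (x - z).
    move=> z zr; have [z1|z1] := ltP (v z) 1.
      rewrite mulr1 (vBC Cp) v_sub_far //.
      by rewrite -(@ltr_pXn2r _ m.+1) ?nnegrE // vxm mz.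
    by rewrite v_sub_far ?(lt_le_trans x1) // ler_piMl // ltW.
  move: r => s; elim: s => [|z s IH] hs; first by rewrite !big_nil mulr1.
  rewrite !big_cons /= exprS mulrACA ler_pM ?mulr_ge0 ?exprn_ge0 ?le_max ?ler01 //.
  - by rewrite prodr_ge0 // => y _; rewrite le_max ler01.
  - by apply: hs; rewrite inE eqxx.
  - by apply: IH => y ys; apply: hs; rewrite inE ys orbT.
apply: le_trans; rewrite ler_wpM2r ?prodr_ge0 //.
  by move=> z _; rewrite le_max ler01.
by rewrite -vxm; apply: ler_wiXn2l => //; [exact: ltW | exact: leqW].
Qed.
End Factored.

Lemma residue_sep S y z : residue_domain v S -> S y -> v z <= 1 -> ~ S z -> v (y - z) = 1.
Proof.
move=> [s s1 ->] [hy sy] hz nz; apply/eqP; rewrite eq_le (vB_le Cp) //= leNgt.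
apply/negP => yz; apply: nz; split => // x xs zx; apply: (sy x xs).
exact: (v_dist_lt Cp yz).
Qed.

Lemma residue_le1 S y : residue_domain v S -> S y -> v y <= 1.
Proof. by move=> [s _ ->] []. Qed.

(** Near f - f' lies a rational function N / D without poles on both domains.
    There |D| is constantly equal to the Gauss norm of D, since the roots of D
    lie outside the unit disk or in removed residue classes. As N / D is small
    on the open disk around 0, the Gauss norm of N is small compared with that
    of D, hence N / D is small at x as well. *)
Theorem analytic_element_uniq S S' f f' x :
  residue_domain v S -> residue_domain v S' ->
  open_unit_disk v 0 `<=` S -> open_unit_disk v 0 `<=` S' ->
  analytic_element v S f -> analytic_element v S' f' ->
  (forall y, open_unit_disk v 0 y -> f y = f' y) ->
  S x -> S' x -> f x = f' x.
Proof.
move=> dS dS' US US' af af' ff' Sx S'x; apply/eqP; rewrite -subr_eq0; apply/negP => /negP nz.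
have d0 := v_gt0 Cp nz; set d := v _ in d0.
(* One factor of |p| is lost in [horner_ge_gauss], the other one makes the
   final inequality strict. *)
have e0 : 0 < d * pabs 2 by rewrite mulr_gt0 ?pabs_gt0.
have e1 : 0 < pabs 1 := pabs_gt0 R p_prime 1.
have elt : pabs 1 < 1 by rewrite -(pabs0 p R) pabs_lt.
have [P [Q [hQ hPQ]]] := af _ e0; have [P' [Q' [hQ' hPQ']]] := af' _ e0.
pose N := P * Q' - P' * Q; pose D := Q * Q'.
have [rN hN] := horner_factor N; have [rD hD] := horner_factor D.
have ND y : S y -> S' y -> P.[y] / Q.[y] - P'.[y] / Q'.[y] = N.[y] / D.[y].
  by move=> Sy S'y; rewrite /N /D !hornerE /=; field; rewrite hQ ?hQ'.
have vD y : S y -> S' y -> v D.[y] = gauss_norm D rD.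
  move=> Sy S'y; apply: horner_eq_gauss => //; first exact: residue_le1 Sy.
  move=> z zr z1; have := horner_factor_root hD zr.
  rewrite /D hornerM => /eqP; rewrite mulf_eq0 => /orP[/eqP q0|/eqP q0].
    by apply: (residue_sep dS) z1 _ => // Sz; have := hQ z Sz; rewrite q0 eqxx.
  by apply: (residue_sep dS') z1 _ => // Sz; have := hQ' z Sz; rewrite q0 eqxx.
have gD0 : 0 < gauss_norm D rD.
  by rewrite -(vD x) //; apply: (v_gt0 Cp); rewrite hornerM mulf_neq0 ?hQ ?hQ'.
have [x0 x01 hx0] := horner_ge_gauss hN.
have U0 : open_unit_disk v 0 x0 by rewrite /open_unit_disk /= subr0.
have Sx0 : S x0 := US _ U0; have S'x0 : S' x0 := US' _ U0.
have hN0 : v N.[x0] <= d * pabs 2 * gauss_norm D rD.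
  rewrite -(vD x0) // -ler_pdivrMr; last by rewrite vD.
  rewrite -(vV Cp) -(vM Cp) -ND //.
  apply: (v_dist_le Cp (z := f x0)); first by rewrite (vBC Cp) ltW ?hPQ.
  by rewrite ff' // ltW ?hPQ'.
have hx : v (N.[x] / D.[x]) <= d * pabs 1.
  rewrite (vM Cp) (vV Cp) vD // ler_pdivrMr //.
  apply: le_trans (horner_le_gauss hN (residue_le1 dS Sx)) _.
  rewrite -(ler_pM2l e1); apply: le_trans hx0 _; apply: le_trans hN0 _.
  by rewrite (pabsD p R 1 1) le_eqVlt; apply/orP; left; apply/eqP; ring.
suff : d < d by rewrite ltxx.
have de : d * pabs 1 < d by rewrite gtr_pMr.
have de2 : d * pabs 2 < d by rewrite gtr_pMr // (le_lt_trans _ elt) // pabs_le.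
rewrite {1}/d; apply: (v_dist_lt Cp (z := P.[x] / Q.[x])).
  exact: lt_trans (hPQ _ Sx) de2.
apply: (v_dist_lt Cp (z := P'.[x] / Q'.[x])).
  by rewrite ND //; apply: le_lt_trans de.
by rewrite (vBC Cp); exact: lt_trans (hPQ' _ S'x) de2.
Qed.

(** The closed unit disk without the residue classes in which the reduction of
    H vanishes. *)
Definition unit_locus (H : {poly int}) : set K := [set x | v x <= 1 /\ v (ev x H) = 1].

Lemma unit_locus_near H x y : v x <= 1 -> v (y - x) < 1 -> unit_locus H x -> unit_locus H y.
Proof.
move=> hx yx [_ Hx].
have hy : v y <= 1 by rewrite -[y](subrK x); apply: (vD_le Cp) => //; exact: ltW.
split => //; apply: (v_unit_of_lt Cp Hx).
exact: le_lt_trans (ev_dist Cp _ hy hx) yx.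
Qed.

(** The residue classes to remove are those of the integral roots of H: on
    such a class |H| < 1, and elsewhere each factor x - z of H has the same
    absolute value as at 0, where |H| = 1. *)
Lemma unit_locus_residue H : v (ev 0 H) = 1 -> residue_domain v (unit_locus H).
Proof.
move=> H0; pose P := map_poly intr H : {poly K}.
have [r hr] := horner_factor P.
have root_far x z : unit_locus H x -> z \in r -> v z <= 1 -> v (x - z) = 1.
  move=> gx zr z1; have [x1 Hx] := gx.
  apply/eqP; rewrite eq_le (vB_le Cp) //= leNgt; apply/negP => xz.
  have [_] : unit_locus H z by apply: unit_locus_near gx => //; rewrite (vBC Cp).
  rewrite /ev -/P (horner_factor_root hr zr) (v0 Cp) => /esym/eqP; by rewrite oner_eq0.
have g0 : unit_locus H 0 by split => //; rewrite (v0 Cp).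
have v00 : v 0 = 0 by exact: v0 Cp.
exists [seq z <- r | v z <= 1].
  by move=> z; rewrite mem_filter => /andP[].
apply/seteqP; split => x.
  move=> gx; split; first by have [] := gx.
  move=> z; rewrite mem_filter => /andP[z1 zr]; rewrite /open_unit_disk /= root_far //.
  by rewrite ltxx.
move=> [x1 h]; split => //.
rewrite -H0 /ev -/P !(horner_eq_gauss hr) ?v00 ?ler01 //.
  by move=> z zr z1; apply: root_far.
move=> z zr z1; apply/eqP; rewrite eq_le (vB_le Cp) //= leNgt; apply/negP => xz.
by apply: (h z) => //; rewrite mem_filter z1.
Qed.
End Analytic.

(** * Morita's gamma function *)

Section GammaNat.
Variables (p : nat) (p_prime : prime p) (p_odd : odd p).
Local Notation pdvd := (pdvd p).

(** The product of the integers below n that are prime to p. *)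
Definition pfact (n : nat) : int := \prod_(0 <= j < n | ~~ (p %| j)%N) j%:Z.

Lemma pfactS n : pfact n.+1 = pfact n * (if (p %| n)%N then 1 else n%:Z).
Proof. by rewrite /pfact big_mkcond big_nat_recr //= -big_mkcond; case: (p %| n)%N. Qed.

Lemma pdvd_prod (A : comNzRingType) (I : Type) (s : seq I) (P : pred I) (F F' : I -> A) k :
  (forall i, P i -> pdvd k (F i - F' i)) ->
  pdvd k (\prod_(i <- s | P i) F i - \prod_(i <- s | P i) F' i).
Proof.
move=> h; elim/big_rec2: _ => [|i x y Pi hx]; first by rewrite subrr; apply: pdvd0.
have -> : F i * y - F' i * x = (F i - F' i) * y + F' i * (y - x) by ring.
by apply: pdvdD; [apply: pdvdMr; apply: h | apply: pdvdMl].
Qed.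

Lemma dvdn_addX k j n : (p %| j + n * p ^ k.+1)%N = (p %| j)%N.
Proof. by rewrite expnS mulnCA dvdn_addl // dvdn_mulr. Qed.

Lemma pfact_shift k n : pdvd k.+1 (pfact (p ^ k.+1 + n) - pfact (p ^ k.+1) * pfact n).
Proof.
rewrite {1}/pfact (big_cat_nat (n := (p ^ k.+1)%N)) ?leq_addr //= -/(pfact _) -mulrBr.
apply: pdvdMl; rewrite -{1}[(p ^ k.+1)%N]add0n big_addn addKn.
rewrite (eq_bigl (fun j => ~~ (p %| j)%N)); last first.
  by move=> j; rewrite -[(p ^ _)%N]mul1n dvdn_addX.
apply: pdvd_prod => j _; exists 1; rewrite PoszD addrAC subrr add0r.
by rewrite -mulr_natr mul1r natz.
Qed.

(** The integers below n p ^ (k + 1), arranged in n rows of length p ^ (k +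
    1), multiplied column by column. *)
Lemma pfact_blocks k n :
  pfact (n * p ^ k.+1) =
  \prod_(0 <= j < p ^ k.+1 | ~~ (p %| j)%N) \prod_(i < n) (j + i * p ^ k.+1)%N%:Z.
Proof.
elim: n => [|n IH].
  by rewrite /pfact big_geq // big1 // => j _; rewrite big_ord0.
have le : (n * p ^ k.+1 <= n.+1 * p ^ k.+1)%N by rewrite mulSn leq_addl.
rewrite /pfact (big_cat_nat (n := (n * p ^ k.+1)%N)) //= -/(pfact _) IH.
rewrite -{1}[(n * _)%N]add0n big_addn mulSn addnK.
rewrite [X in _ * X](eq_bigl (fun j => ~~ (p %| j)%N)); last first.
  by move=> j; rewrite dvdn_addX.
by rewrite -big_split /=; apply: eq_bigr => j _; rewrite big_ord_recr.
Qed.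

Lemma arith_prod (A : comNzRingType) (x y : A) n :
  exists z, \prod_(i < n) (x + y *+ i) = x ^+ n + x ^+ n.-1 * y *+ 'C(n, 2) + y ^+ 2 * z.
Proof.
elim: n => [|n [z IH]].
  by exists 0; rewrite big_ord0 mulr0n mulr0 !addr0 expr0.
rewrite big_ord_recr /= IH; case: n IH => [|n] IH.
  by exists (z * x); rewrite !bin_small // !mulr0n; ring.
exists (x ^+ n *+ ('C(n.+1, 2) * n.+1) + z * (x + y *+ n.+1)).
have -> : 'C(n.+2, 2) = ('C(n.+1, 2) + n.+1)%N by rewrite binS bin1.
rewrite /= !exprSr.
by move: (x ^+ n) 'C(n.+1, 2) n.+1 => X c N; ring.
Qed.

(** Wilson's theorem modulo p ^ (k + 1). In the step, the integers below p ^
    (k + 2) with the same residue j modulo p ^ (k + 1) form an arithmetic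
    progression of p terms, whose product is j ^ p modulo p ^ (k + 2) because
    p is odd. The product of all of them is thus the p-th power of the product
    x below p ^ (k + 1), and x = -1 modulo p ^ (k + 1) implies x ^ p = -1
    modulo p ^ (k + 2). *)
Lemma wilson_pX k : pdvd k.+1 (pfact (p ^ k.+1) + 1).
Proof.
elim: k => [|k IH].
  have : (p %| (p.-1)`!.+1)%N by rewrite -Wilson ?prime_gt1.
  have -> : pfact (p ^ 1) = (p.-1)`!%:Z.
    rewrite expn1 /pfact big_ltn_cond ?prime_gt0 // dvdn0 /=.
    rewrite fact_prod prednK ?prime_gt0 // -(natz (\prod_(_ <= _ < _) _)) natr_prod.
    rewrite [LHS]big_mkcond; apply: eq_big_nat => j /andP[j0 jp].
    rewrite natz ifT //; apply/negP => /(dvdn_leq j0).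
    by rewrite leqNgt jp.
  move=> /dvdnP[m em]; exists m%:Z.
  have -> : (p.-1)`!%:Z + 1 = ((p.-1)`!.+1)%:Z by rewrite -addn1 PoszD.
  by rewrite em expn1 PoszM -mulr_natr natz.
have W : pdvd k.+2 (pfact (p ^ k.+2) - pfact (p ^ k.+1) ^+ p).
  rewrite (expnS p k.+1) pfact_blocks /pfact -prodrXl.
  apply: pdvd_prod => j _.
  (* The second order term is divisible by the square of p ^ (k + 1), the
     first order one by p ^ (k + 1) times 'C(p, 2). *)
  have [z ez] := arith_prod j%:Z (p ^ k.+1)%:Z p.
  have -> : \prod_(i < p) ((j + i * p ^ k.+1)%N%:Z) = \prod_(i < p) (j%:Z + (p ^ k.+1)%:Z *+ i).
    by apply: eq_bigr => i _; rewrite PoszD PoszM -mulr_natl natz.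
  have cancel (s t w : int) : s + t + w - s = t + w by ring.
  rewrite ez cancel.
  have pk : pdvd k.+1 (p ^ k.+1)%:Z by exists 1; rewrite -mulr_natr mul1r natz.
  apply: pdvdD; last first.
    apply: pdvdMr; apply: (@pdvdW _ _ _ (k.+1 + k.+1)); first by lia.
    by rewrite expr2; apply: pdvdM.
  have [m em] : exists m, 'C(p, 2) = (m * p)%N.
    by apply/dvdnP; rewrite bin2odd // dvdn_mulr.
  rewrite em mulrnA -(addn1 k.+1) -mulr_natr; apply: pdvdM.
    rewrite -mulr_natr; apply: pdvdMr; exact: pdvdMl.
  by exists 1; rewrite expn1.
have h : pdvd k.+2 (pfact (p ^ k.+1) ^+ p - (-1) ^+ p).
  by apply: pdvd_lift => //; rewrite opprK.
have := pdvd_trans W h.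
by rewrite -signr_odd p_odd expr1 opprK.
Qed.

(** Morita's function on natural numbers, with integer values. *)
Definition gammaz n : int := (-1) ^+ n * pfact n.

Lemma sign_pX k n : (-1) ^+ (p ^ k + n) = - (-1) ^+ n :> int.
Proof. by rewrite exprD -[(-1) ^+ (p ^ k)]signr_odd oddX p_odd orbT mulN1r. Qed.

Lemma gammaz_shift k n : pdvd k.+1 (gammaz (p ^ k.+1 + n) - gammaz n).
Proof.
rewrite /gammaz sign_pX.
have [a ea] := pfact_shift k n; have [b eb] := wilson_pX k.
move/(congr1 (+%R^~ (pfact (p ^ k.+1) * pfact n))): ea; rewrite subrK => ->.
have -> : pfact (p ^ k.+1) = b *+ p ^ k.+1 - 1 by rewrite -eb addrK.
exists (- (-1) ^+ n * (a + b * pfact n)).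
by move: (p ^ k.+1)%N ((-1) ^+ n) (pfact n) => q s U; ring.
Qed.

Lemma gammaz_shiftM k n q : pdvd k.+1 (gammaz (n + q * p ^ k.+1) - gammaz n).
Proof.
elim: q => [|q IH]; first by rewrite addn0 subrr; apply: pdvd0.
by rewrite mulSn addnCA; apply: pdvd_trans IH; apply: gammaz_shift.
Qed.

(** The substitution j |-> p ^ (k + 1) - j changes the sign of each of the
    factors among the last n integers; n + n / p has the parity of the number
    n - n / p of those that are prime to p. *)
Lemma pfact_reflect k n : (n <= p ^ k.+1)%N ->
  pdvd k.+1 (pfact (p ^ k.+1) - pfact (p ^ k.+1 - n) * ((-1) ^+ (n + n %/ p) * pfact n.+1)).
Proof.
elim: n => [_|n IH lt].
  rewrite subn0 div0n expr0 mul1r pfactS dvdn0 /pfact [in X in _ * X]big_geq // !mulr1 subrr.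
  exact: pdvd0.
apply: pdvd_trans (IH (ltnW lt)) _.
set q := (p ^ k.+1)%N in lt *.
have -> : (q - n = (q - n.+1).+1)%N by rewrite subnSK.
rewrite pfactS (pfactS n.+1) divnS ?prime_gt0 //.
have dv : (p %| q - n.+1)%N = (p %| n.+1)%N.
  have pq : (p %| q)%N by rewrite /q expnS dvdn_mulr.
  by rewrite dvdn_subr.
rewrite dv; case: ifP => _ /=.
  rewrite add1n addSn addnS !exprS !mulN1r opprK mulr1 mulr1 subrr; exact: pdvd0.
rewrite add0n addSn exprS mulN1r.
have -> : (q - n.+1)%:Z = q%:Z - n.+1%:Z by rewrite -subzn.
exists (pfact (q - n.+1) * ((-1) ^+ (n + n %/ p) * pfact n.+1)).
rewrite -mulr_natr natz; ring.
Qed.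

Lemma gammaz_reflect k n : (n <= p ^ k.+1)%N ->
  pdvd k.+1 (gammaz (p ^ k.+1 - n) * pfact n.+1 - (-1) ^+ (n %/ p)).
Proof.
move=> le; have [a ea] := pfact_reflect le; have [b eb] := wilson_pX k.
have es : (-1) ^+ (p ^ k.+1 - n) = - (-1) ^+ n :> int.
  rewrite -(sign_pX k.+1) -{2}(subnK le) -addnA addnn exprD -[X in _ = _ * X]signr_odd odd_double.
  by rewrite mulr1.
rewrite /gammaz es.
set x := pfact (_ - _) in ea *.
have s2 : (-1) ^+ n * (-1) ^+ n = 1 :> int by rewrite -exprD addnn -signr_odd odd_double.
have t2 : (-1) ^+ (n %/ p) * (-1) ^+ (n %/ p) = 1 :> int by rewrite -exprD addnn -signr_odd odd_double.
exists ((-1) ^+ (n %/ p) * (a - b)).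
rewrite -mulrnAr mulrnBl -ea -eb exprD.
set s := (-1) ^+ n in s2 *; set t := (-1) ^+ (n %/ p) in t2 *; set P := pfact n.+1; set Q := pfact _.
have -> : t * (Q - x * (s * t * P) - (Q + 1)) = - (x * s * P) * (t * t) - t by ring.
rewrite t2; ring.
Qed.

(** The multiples of p up to n contribute p ^ (n / p) (n / p)!. *)
Lemma fact_pfact n :
  (n`!)%:Z = pfact n.+1 * p%:Z ^+ (n %/ p) * ((n %/ p)`!)%:Z.
Proof.
have p0 := prime_gt0 p_prime.
elim: n => [|n IH].
  by rewrite div0n pfactS dvdn0 /pfact big_geq.
rewrite factS PoszM IH (pfactS n.+1) divnS //.
case: ifP => [/dvdnP[m em]|_] /=; last by rewrite add0n; ring.
have em' : m = (n %/ p).+1.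
  by have := divnS n p0; rewrite em mulnK // dvdn_mull // add1n.
rewrite em em' add1n exprS factS !PoszM; ring.
Qed.
End GammaNat.

Section GammaP.
Variables (p : nat) (R : realType) (K : closedFieldType) (v : K -> R).
Hypotheses (p_prime : prime p) (p_odd : odd p) (Cp : is_Cp p v).
Local Notation pabs := (pabs p R).

Lemma v_pdvd k (x : int) : pdvd p k x -> v x%:~R <= pabs k.
Proof. by move=> [z ->]; rewrite rmorphMn; apply: (v_pmulr Cp); apply: (v_int Cp). Qed.

Lemma Gamma_natE n : Gamma_nat p K n = (gammaz p n)%:~R.
Proof.
rewrite /Gamma_nat /gammaz rmorphM rmorph_sign /= /pfact rmorph_prod /=; congr (_ * _).
case: n => [|n]; first by rewrite !big_geq.
by rewrite [RHS]big_ltn_cond // dvdn0 /=; apply: eq_bigr => j _; rewrite pmulrn.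
Qed.

Lemma v_Gamma_nat n : v (Gamma_nat p K n) = 1.
Proof.
rewrite /Gamma_nat (vM Cp) (v_sign Cp) mul1r (v_prod Cp) big1 // => j pj.
by apply: (v_coprime p_prime Cp); rewrite prime_coprime.
Qed.

Lemma v_pfact n : v (pfact p n)%:~R = 1.
Proof.
rewrite /pfact rmorph_prod /= (v_prod Cp) big1 // => j pj.
by rewrite -pmulrn; apply: (v_coprime p_prime Cp); rewrite prime_coprime.
Qed.

Lemma Gamma_nat_cont k m n : v (m%:R - n%:R) <= pabs k ->
  v (Gamma_nat p K m - Gamma_nat p K n) <= pabs k.
Proof.
wlog nm : m n / (n <= m)%N.
  by move=> W h; case: (leqP n m) => [|/ltnW] hh; [apply: W | rewrite (vBC Cp); apply: W => //; rewrite (vBC Cp)].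
move=> /(v_natB_dvd p_prime Cp nm).
case: k => [_|k].
  by rewrite pabs0; apply: (vB_le Cp); rewrite v_Gamma_nat.
move=> /dvdnP[q eq]; rewrite !Gamma_natE -rmorphB /=; apply: v_pdvd.
by rewrite -(subnKC nm) eq; apply: gammaz_shiftM.
Qed.

(** Since [Gamma_nat] preserves congruences modulo p ^ k, it converges along
    every sequence of natural numbers that tends to x. *)
Lemma Gamma_p_lim x (u : nat -> nat) : (forall k, v ((u k)%:R - x) <= pabs k) ->
  vlim v (fun k => Gamma_nat p K (u k)) (Gamma_p p v x).
Proof.
move=> hu.
have st k : v (Gamma_nat p K (u k.+1) - Gamma_nat p K (u k)) <= pabs k.
  apply: Gamma_nat_cont; apply: (v_dist_le Cp (z := x)); last by rewrite (vBC Cp).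
  by apply: le_trans (hu _) _; rewrite pabs_le.
have [hl hd] := vlimitP p_prime Cp st.
suff -> : Gamma_p p v x = vlimit v (fun k => Gamma_nat p K (u k)) by [].
apply: xget_unique => /= [e e0|y hy].
  have [k hk] := pabs_small p_prime e0; exists (pabs k); first exact: pabs_gt0.
  move=> n hn; apply: le_lt_trans hk; apply: (v_dist_le Cp) (hd k).
  apply: Gamma_nat_cont; apply: (v_dist_le Cp (z := x)); first exact: ltW.
  by rewrite (vBC Cp).
apply: (vlim_uniq Cp) hl => e e0; have [d d0 hd'] := hy e e0.
have [k hk] := pabs_small p_prime d0; exists k => n kn; apply: hd'.
by apply: le_lt_trans (hu n) _; apply: le_lt_trans hk; apply: pabs_le.
Qed.

(** Morita's reflection formula for natural numbers: n + 1 and p ^ k - n have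
    sum 1 modulo p ^ k, and [pfact] is Morita's function up to sign. *)
Lemma Gamma_reflect k n : (n <= p ^ k)%N ->
  v (Gamma_nat p K (p ^ k - n) * (pfact p n.+1)%:~R - (-1) ^+ (n %/ p)) <= pabs k.
Proof.
case: k => [_|k le].
  rewrite pabs0; apply: (vB_le Cp); last by rewrite (v_sign Cp).
  by rewrite (vM Cp) v_pfact v_Gamma_nat mulr1.
rewrite Gamma_natE -(rmorph_sign intr) -rmorphM -rmorphB /=.
by apply: v_pdvd; apply: gammaz_reflect.
Qed.
End GammaP.

(** * Truncated hypergeometric polynomials and p-adic digits *)

(** The generating function of [hyperpoly]; the variable of the outer
    polynomial ring is t, that of the inner one lambda. *)
Definition hyperG (N L : nat) : {poly {poly int}} :=
  (1 + 'X) ^+ (L - N) * (1 + (1 - 'X)%:P * 'X) ^+ N.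
(** The polynomial 'C(L, M) F(- N, - M, - L; lambda). *)
Definition hyperpoly (N M L : nat) : {poly int} := (hyperG N L)`_M.

Lemma size_lin_exp (A : comNzRingType) (c : A) n : (size ((1 + c%:P * 'X) ^+ n) <= n.+1)%N.
Proof.
apply: leq_trans (size_poly_exp_leq _ _) _; rewrite ltnS -[leqRHS]mul1n leq_mul2r; apply/orP; right.
have : (size (1 + c%:P * 'X)%R <= 2)%N.
  have -> : 1 + c%:P * 'X = c%:P * 'X + 1%:P by rewrite addrC polyC1.
  by rewrite size_MXaddC; case: ifP => // _; rewrite ltnS size_polyC leq_b1.
by case: (size _) => // k; rewrite ltnS.
Qed.

Lemma size_hyperG N L : (N <= L)%N -> (size (hyperG N L) <= L.+1)%N.
Proof.
move=> NL; apply: leq_trans (size_polyMleq _ _) _.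
have h1 : (size ((1 + 'X : {poly {poly int}}) ^+ (L - N)) <= (L - N).+1)%N.
  by have := size_lin_exp (1 : {poly int}) (L - N); rewrite polyC1 mul1r.
have h2 := size_lin_exp (1 - 'X : {poly int}) N.
by rewrite -subn1 leq_subLR; apply: leq_trans (leq_add h1 h2) _; lia.
Qed.

Lemma coef_1DXn (A : comNzRingType) n i : ((1 + 'X : {poly A}) ^+ n)`_i = 'C(n, i)%:R.
Proof.
rewrite addrC exprD1n coef_sum.
have [ni|ni] := ltnP n i.
  by rewrite bin_small // big1 // => j _; rewrite coefMn coefXn gtn_eqF ?mul0rn // (leq_ltn_trans _ ni) // -ltnS.
have h : (i < n.+1)%N by [].
rewrite (bigD1 (Ordinal h)) //= big1 => [|j jn]; first by rewrite addr0 coefMn coefXn eqxx.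
by rewrite coefMn coefXn -[_ == _](inj_eq val_inj) /= in jn *; rewrite eq_sym (negbTE jn) mul0rn.
Qed.

Section Eval.
Variables (K : closedFieldType).

Definition ev_morph (y : K) : {rmorphism {poly int} -> K} :=
  GRing.RMorphism.clone _ _ (horner_eval y \o map_poly intr) _.
Lemma ev_morphE y P : ev_morph y P = ev y P. Proof. by []. Qed.

Lemma ev_hyperpoly (y : K) N M L :
  ev y (hyperpoly N M L) = ((1 + 'X) ^+ (L - N) * (1 + (1 - y)%:P * 'X) ^+ N)`_M.
Proof.
have e1 : map_poly (ev_morph y) (1 + 'X) = 1 + 'X by rewrite rmorphD rmorph1 /= map_polyX.
have e2 : map_poly (ev_morph y) (1 + (1 - 'X)%:P * 'X) = 1 + (1 - y)%:P * 'X.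
  rewrite rmorphD rmorphM rmorph1 /= map_polyX map_polyC /=.
  by rewrite rmorphB rmorph1 /= map_polyX horner_evalE !hornerE.
by rewrite -ev_morphE /hyperpoly -coef_map rmorphM !rmorphXn /= e1 e2.
Qed.

Lemma ev1_hyperpoly N M L : ev (1 : K) (hyperpoly N M L) = 'C(L - N, M)%:R.
Proof. by rewrite ev_hyperpoly subrr mul0r addr0 expr1n mulr1 coef_1DXn. Qed.

Lemma ev0_hyperpoly N M L : (N <= L)%N -> ev (0 : K) (hyperpoly N M L) = 'C(L, M)%:R.
Proof. by move=> NL; rewrite ev_hyperpoly subr0 mul1r -exprD subnK // coef_1DXn. Qed.

Definition hyperpoly_coef (N M L k : nat) : K :=
  if (M < k)%N then 0 else ('C(N, k) * 'C(L - k, M - k))%:R * (-1) ^+ k.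

(** Expand (1 + (1 - y) t) ^ N = ((1 + t) - y t) ^ N by the binomial formula
    and collect the powers of 1 + t. *)
Lemma ev_hyperpoly_sum (y : K) N M L D : (N <= L)%N -> (N < D)%N ->
  ev y (hyperpoly N M L) = \sum_(k < D) hyperpoly_coef N M L k * y ^+ k.
Proof.
move=> NL ND; rewrite ev_hyperpoly.
have -> : 1 + (1 - y)%:P * 'X = (1 + 'X) - y%:P * 'X :> {poly K}.
  by rewrite polyCB polyC1; ring.
rewrite exprBn mulr_sumr coef_sum.
rewrite (big_ord_widen D (fun i => ((1 + 'X) ^+ (L - N) * ((-1) ^+ i * (1 + 'X) ^+ (N - i) * (y%:P * 'X) ^+ i *+ 'C(N, i)))`_M)) //.
rewrite big_mkcond /=; apply: eq_bigr => k _; case: ifP => [kN|]; last first.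
  by move/negbT; rewrite -leqNgt /hyperpoly_coef => Nk; rewrite bin_small // mul0n mul0r if_same mul0r.
rewrite /hyperpoly_coef mulrnAr coefMn exprMn -polyC_exp.
have -> : (1 + 'X) ^+ (L - N) * ((-1) ^+ k * (1 + 'X) ^+ (N - k) * ((y ^+ k)%:P * 'X^k))
   = ((-1) ^+ k * y ^+ k)%:P * ((1 + 'X) ^+ (L - k) * 'X^k) :> {poly K}.
  have -> : (L - k = (L - N) + (N - k))%N by lia.
  by rewrite polyCM !polyC_exp polyCN polyC1 exprD; ring.
rewrite coefCM coefMXn; case: ifP => _; first by rewrite mulr0 mul0rn mul0r.
rewrite coef_1DXn natrM -mulr_natr; ring.
Qed.

Lemma pochhammerS (a : K) k : pochhammer a k.+1 = pochhammer a k * (a + k%:R).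
Proof. by rewrite /pochhammer big_ord_recr. Qed.
Lemma pochhammer0 (a : K) : pochhammer a 0 = 1.
Proof. by rewrite /pochhammer big_ord0. Qed.

Lemma pochhammer_neg N k : pochhammer (- N%:R : K) k = (-1) ^+ k * (N ^_ k)%:R.
Proof.
elim: k => [|k IH]; first by rewrite pochhammer0 ffactn0 mulr1.
rewrite pochhammerS IH ffactnSr exprS natrM.
have [kN|Nk] := leqP k N; first by rewrite natrB //; ring.
by rewrite ffact_small // !(mul0r, mulr0).
Qed.
End Eval.

Section Digits.
Variables (p : nat) (R : realType) (K : closedFieldType) (v : K -> R).
Hypotheses (p_prime : prime p) (Cp : is_Cp p v).
Local Notation pabs := (pabs p R).

Lemma bin_shift L M k : (k <= M)%N -> (M <= L)%N ->
  ('C(L - k, M - k) * L ^_ k = 'C(L, M) * M ^_ k)%N.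
Proof.
move=> kM ML.
have e1 : (L - k - (M - k) = L - M)%N by lia.
have b1 := bin_fact (leq_sub2r k ML); rewrite e1 in b1.
have b2 := bin_fact ML.
have f1 := ffact_fact (leq_trans kM ML); have f2 := ffact_fact kM.
apply/eqP; rewrite -(@eqn_pmul2r ((M - k)`! * (L - M)`!)) ?muln_gt0 ?fact_gt0 //.
apply/eqP; nia.
Qed.

Lemma hyperpoly_coefE N M L k : (N <= L)%N -> (M <= L)%N ->
  hyperpoly_coef K N M L k = 'C(L, M)%:R * hypergeom (- N%:R) (- M%:R) (- L%:R) k.
Proof.
move=> NL ML; rewrite /hyperpoly_coef /hypergeom !pochhammer_neg; case: ltnP => [Mk|kM].
  by rewrite (ffact_small Mk) !(mulr0, mul0r).
have L0 : (L ^_ k)%:R != 0 :> K.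
  by apply: (natK_neq0 p_prime Cp); rewrite ffact_gt0 (leq_trans kM).
have k0 : (k`!)%:R != 0 :> K by apply: (natK_neq0 p_prime Cp); rewrite fact_gt0.
have s0 : (-1) ^+ k != 0 :> K by rewrite signr_eq0.
have eN : (N ^_ k)%:R = 'C(N, k)%:R * (k`!)%:R :> K by rewrite -natrM bin_ffact.
have eB : 'C(L - k, M - k)%:R = 'C(L, M)%:R * (M ^_ k)%:R / (L ^_ k)%:R :> K.
  by apply: (canRL (mulfK L0)); rewrite -!natrM bin_shift.
rewrite natrM eB eN; field.
by rewrite k0 s0 L0.
Qed.

Lemma v_hyperpoly_coef N M L k : v (hyperpoly_coef K N M L k) <= 1.
Proof.
rewrite /hyperpoly_coef; case: ifP => _; first by rewrite (v0 Cp).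
by rewrite (vM Cp) (v_sign Cp) mulr1 (v_nat Cp).
Qed.

Lemma v_bin_small m n : (n < p)%N -> (m <= n)%N -> v 'C(n, m)%:R = 1.
Proof.
move=> np mn; have /(congr1 (fun k => v k%:R)) := bin_fact mn.
have vf k : (k < p)%N -> v (k`!)%:R = 1.
  elim: k => [|k IH] kp; first by rewrite (v1 Cp).
  by rewrite factS natrM (vM Cp) IH ?(ltnW kp) // mulr1 (v_small_unit p_prime Cp).
by rewrite natrM natrM !(vM Cp) !vf ?mulr1 //; lia.
Qed.

Lemma padic_int_le1 x : padic_int v x -> v x <= 1.
Proof.
move=> /(_ 1 ltr01) [_ [z _ <-] h].
by rewrite -[x](subrK (z%:~R)); apply: (vD_le Cp); [exact: ltW | exact: v_int Cp z].
Qed.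

Lemma v_int_lt1 (z : int) : v z%:~R < 1 -> (p %| z)%Z.
Proof.
rewrite dvdzE /=; case: z => n /=; first by rewrite -pmulrn; apply: (v_nat_lt1 p_prime Cp).
by rewrite NegzE mulrNz (vN Cp) -pmulrn; apply: (v_nat_lt1 p_prime Cp).
Qed.

(** An integer close to x is congruent to - m modulo p for some m < p;
    division of x + m by p keeps it in the closure of the integers. *)
Lemma dprime_ex x : padic_int v x ->
  exists y, padic_int v y /\ exists2 m : nat, (m < p)%N & p%:R * y - x = m%:R.
Proof.
move=> hx; have p0 := prime_gt0 p_prime.
have pz0 : p%:Z != 0 by rewrite eqz_nat -lt0n.
have [_ [z _ <-] h] := hx (pabs 1) (pabs_gt0 R p_prime 1).
pose m := `|(- z) %% p%:Z|%Z%N.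
have em : m%:Z = ((- z) %% p%:Z)%Z by rewrite /m gez0_abs // modz_ge0.
have mp : (m < p)%N by rewrite -ltz_nat em ltz_mod.
have dv : (p %| z + m%:Z)%Z.
  have -> : z + m%:Z = - ((- z) %/ p%:Z)%Z * p%:Z.
    by rewrite em; have := divz_eq (- z) p%:Z; lia.
  exact: dvdz_mull.
have pK := p_neq0 p_prime Cp.
exists ((x + m%:R) / p%:R); split; last first.
  by exists m => //; rewrite mulrC divfK // addrAC subrr add0r.
move=> e e0.
have e1 : 0 < Num.min (pabs 1) (e * pabs 1) by rewrite lt_min pabs_gt0 // mulr_gt0 ?pabs_gt0.
have [_ [z' _ <-]] := hx _ e1; rewrite lt_min => /andP[h1 h2].
have dz : (p %| z' - z)%Z.
  apply: v_int_lt1; rewrite rmorphB; apply: (v_dist_lt Cp (z := x)).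
    by rewrite (vBC Cp); apply: lt_trans h1 _; rewrite -(pabs0 p R) pabs_lt.
  by apply: lt_trans h _; rewrite -(pabs0 p R) pabs_lt.
have : (p %| z' + m%:Z)%Z.
  have -> : z' + m%:Z = (z' - z) + (z + m%:Z) by ring.
  by rewrite rpredD.
move=> /dvdzP[q eq]; exists q%:~R; first by exists q.
have -> : q%:~R = (z' + m%:Z)%:~R / p%:R :> K by rewrite eq rmorphM /= -pmulrn mulfK.
rewrite -mulrBl rmorphD /= -pmulrn opprD addrACA subrr addr0 (vM Cp) (vV Cp) (vp Cp) invrK.
by move: h2; rewrite -ltr_pdivrMr ?pabs_gt0 // pabs1 invrK.
Qed.

Lemma dprimeP x : padic_int v x ->
  [/\ padic_int v (dprime p v x), (mu p v x < p)%N & p%:R * dprime p v x - x = (mu p v x)%:R].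
Proof.
move=> hx.
have [h1 [m mp hm]] : padic_int v (dprime p v x) /\
    exists2 m : nat, (m < p)%N & p%:R * dprime p v x - x = m%:R.
  exact: (xgetPex 0 (dprime_ex hx)).
have [h2 h3] : (mu p v x < p)%N /\ p%:R * dprime p v x - x = (mu p v x)%:R.
  apply: (@xgetPex _ 0%N [set m : nat | (m < p)%N /\ p%:R * dprime p v x - x = m%:R]).
  by exists m.
by split.
Qed.

(** The base p digits of - x. *)
Definition digit x i := mu p v (dprime_iter p v i x).

Lemma dprime_iter_int x i : padic_int v x -> padic_int v (dprime_iter p v i x).
Proof. by move=> hx; elim: i => [|i IH] //=; have [] := dprimeP IH. Qed.

Lemma digit_lt x i : padic_int v x -> (digit x i < p)%N.
Proof. by move=> hx; have [] := dprimeP (dprime_iter_int i hx). Qed.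

(** From x = p x' - mu_x, applied n times. *)
Lemma digit_approx x k n : padic_int v x ->
  v (dprime_iter p v k x + (digsum p (digit x) k n)%:R) <= pabs n.
Proof.
move=> hx; elim: n k => [|n IH] k.
  by rewrite digsum0 addr0 pabs0; apply: padic_int_le1; apply: dprime_iter_int.
have [_ _ e] := dprimeP (dprime_iter_int k hx).
rewrite -add1n digsumD digsum1 natrD natrM expn1.
have -> : dprime_iter p v k x = p%:R * dprime_iter p v (k + 1) x - (digit x k)%:R.
  by rewrite addn1 /= -e; ring.
rewrite addrA subrK -mulrDr (vM Cp) (vp Cp) pabsD pabs1.
by rewrite ler_pM2l ?invr_gt0 ?pR_gt0.
Qed.

Lemma neg_digsum_vlim x k n0 : padic_int v x ->
  vlim v (fun n => - (digsum p (digit x) k (n0 + n))%:R) (dprime_iter p v k x).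
Proof.
move=> hx; apply: (vlim_rate p_prime) => n; rewrite -opprD (vN Cp) addrC.
by apply: le_trans (digit_approx k (n0 + n) hx) _; rewrite pabs_le ?leq_addl.
Qed.

(** All the digits of - x^(k) are positive, whereas those of a natural number
    eventually vanish. *)
Lemma no_neg_nat x k j : padic_int v x -> (forall i, (0 < digit x i)%N) ->
  dprime_iter p v k x + j%:R != 0.
Proof.
move=> hx h0; apply/negP; rewrite addr_eq0 => /eqP e.
have := digit_approx k j.+1 hx; rewrite e addrC.
set L := digsum _ _ _ _ => hL.
have L1 : (p ^ j <= L)%N by rewrite /L digsumS -[leqLHS]add0n leq_add // leq_pmull.
have L2 : (L < p ^ j.+1)%N by apply: digsum_lt => // i; apply: digit_lt.
have jp : (j < p ^ j)%N by rewrite ltn_expl ?prime_gt1.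
have jL : (j <= L)%N by lia.
have := v_natB_dvd p_prime Cp jL hL => /dvdn_leq; lia.
Qed.

Lemma pochhammer_neq0 x k n : padic_int v x -> (forall i, (0 < digit x i)%N) ->
  pochhammer (dprime_iter p v k x) n != 0.
Proof.
move=> hx h0; rewrite /pochhammer prodf_seq_neq0; apply/allP => j _ /=.
exact: no_neg_nat.
Qed.

Lemma hypergeom_vlim (u1 u2 u3 : nat -> K) a b c k :
  vlim v u1 a -> vlim v u2 b -> vlim v u3 c -> pochhammer c k != 0 ->
  vlim v (fun s => hypergeom (u1 s) (u2 s) (u3 s) k) (hypergeom a b c k).
Proof.
move=> h1 h2 h3 c0.
have hp u l : vlim v u l -> vlim v (fun s => pochhammer (u s) k) (pochhammer l k).
  move=> h; apply: (vlim_prod Cp) => i; apply: (vlimD Cp) => //; exact: (vlim_cst Cp).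
apply: (vlimM Cp); first by apply: (vlimM Cp); apply: hp.
apply: (vlimV Cp); first by rewrite mulf_neq0 // (natK_neq0 p_prime Cp) // fact_gt0.
apply: (vlimM Cp); [exact: hp | exact: (vlim_cst Cp)].
Qed.
End Digits.

(** * Quotients of power series and of binomial coefficients *)

Section Expansion.
Variables (p : nat) (R : realType) (K : closedFieldType) (v : K -> R).
Hypotheses (p_prime : prime p) (Cp : is_Cp p v).

(** When the constant term of the denominator has absolute value 1, the
    recursion that defines the quotient stays in the ring of integers. *)
Lemma v_ps_quot (F E : nat -> K) : (forall i, v (F i) <= 1) -> (forall i, v (E i) <= 1) ->
  v (E 0%N) = 1 -> forall n, v (ps_quot F E n) <= 1.
Proof.
move=> hF hE E0; elim/ltn_ind => n IH.
have h0 := v_neq0_of Cp E0.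
have := ps_quotP F h0 n; rewrite big_ord_recr /= subnn => e.
have -> : ps_quot F E n = (F n - \sum_(i < n) ps_quot F E i * E (n - i)%N) / E 0%N.
  by rewrite -e addrAC subrr add0r mulfK.
rewrite (v_div_unit Cp) //; apply: (vB_le Cp) => //.
apply: (v_sum Cp) => // i _; apply: (vM_le1 Cp) => //; exact: IH.
Qed.

(** A truncation of the quotient F / E, multiplied by an approximation of E,
    is an approximation of F: coefficients below n agree up to d, and those
    from n on are integral and come with x ^ n. *)
Lemma expansion_approx (F E F' E' : nat -> K) (x : K) n D (d : R) :
  (forall i, v (F i) <= 1) -> (forall i, v (E i) <= 1) -> v (E 0%N) = 1 ->
  (forall i, v (F' i) <= 1) -> (forall i, v (E' i) <= 1) ->
  v x <= 1 -> (n <= D)%N -> 0 <= d ->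
  (forall i, (i < n)%N -> v (F' i - F i) <= d) ->
  (forall i, (i < n)%N -> v (E' i - E i) <= d) ->
  v ((\sum_(i < n) ps_quot F E i * x ^+ i) * (\sum_(i < D) E' i * x ^+ i)
     - \sum_(i < D) F' i * x ^+ i) <= Num.max d (v x ^+ n).
Proof.
move=> hF hE E0 hF' hE' hx nD d0 dF dE.
have hg := v_ps_quot hF hE E0; set g := ps_quot F E in hg *.
pose A := \poly_(i < n) g i; pose B := \poly_(i < D) E' i; pose C := \poly_(i < D) F' i.
have hA i : v A`_i <= 1 by rewrite coef_poly; case: ifP => // _; rewrite (v0 Cp).
have hB i : v B`_i <= 1 by rewrite coef_poly; case: ifP => // _; rewrite (v0 Cp).
have hC i : v C`_i <= 1 by rewrite coef_poly; case: ifP => // _; rewrite (v0 Cp).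
rewrite -[X in X * _ - _](horner_poly n g x) -[X in _ * X](horner_poly D E' x).
rewrite -[X in _ - X](horner_poly D F' x) -/A -/B -/C.
rewrite -hornerM -hornerN -hornerD horner_coef.
apply: (v_sum Cp) => [|i _]; first by rewrite le_max d0.
have [ni|lt] := leqP n i; rewrite le_max; apply/orP; [right|left].
  rewrite -[leRHS]mul1r; apply: (vM_le Cp); last by rewrite (vX Cp) ler_wiXn2l // (Cp_abs_ge0 Cp).
  rewrite coefB; apply: (vB_le Cp) => //; rewrite coefM.
  by apply: (v_sum Cp) => // j _; apply: (vM_le1 Cp).
rewrite -[leRHS]mulr1; apply: (vM_le Cp); last exact: (vX_le1 Cp).
have iD : (i < D)%N := leq_trans lt nD.
rewrite coefB coefM coef_poly iD.
have -> : \sum_(j < i.+1) A`_j * B`_(i - j) - F' i =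
    \sum_(j < i.+1) g j * (E' (i - j)%N - E (i - j)%N) - (F' i - F i).
  have e : \sum_(j < i.+1) g j * E (i - j)%N = F i by apply: ps_quotP (v_neq0_of Cp E0) i.
  have -> : \sum_(j < i.+1) A`_j * B`_(i - j)
      = \sum_(j < i.+1) g j * (E' (i - j)%N - E (i - j)%N) + F i.
    rewrite -e -big_split /=; apply: eq_bigr => j _; rewrite -mulrDr subrK !coef_poly.
    have ji : (j <= i)%N by rewrite -ltnS.
    by rewrite (leq_ltn_trans ji lt) (leq_ltn_trans (leq_subr j i) iD).
  by rewrite opprB addrA.
apply: (vB_le Cp); last exact: dF.
apply: (v_sum Cp) => // j _; rewrite -[leRHS]mul1r; apply: (vM_le Cp) => //.
by apply: dE; apply: leq_ltn_trans lt; apply: leq_subr.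
Qed.
End Expansion.

Section BinPfact.
Variables (p : nat) (p_prime : prime p).

(** When m and n are added in base p without a carry from the last digit, the
    powers of p in the factorials cancel and the factorials of the quotients
    by p form the binomial coefficient without that digit. *)
Lemma bin_pfact m n : (m %% p + n %% p < p)%N ->
  'C(m + n, m)%:Z * (pfact p m.+1 * pfact p n.+1)
  = pfact p (m + n).+1 * 'C(m %/ p + n %/ p, m %/ p)%:Z.
Proof.
move=> lt; have p0 := prime_gt0 p_prime.
have e : ((m + n) %/ p = m %/ p + n %/ p)%N.
  by rewrite divnD // leqNgt lt addn0.
have b1 := bin_fact (leq_addr n m); rewrite addKn in b1.
have b2 := bin_fact (leq_addr (n %/ p) (m %/ p)); rewrite addKn in b2.
move/(congr1 Posz): b1; rewrite !PoszM.
rewrite (fact_pfact p_prime m) (fact_pfact p_prime n) (fact_pfact p_prime (m + n)) e.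
move/(congr1 Posz): b2; rewrite !PoszM => <-; rewrite exprD.
have nz : p%:Z ^+ (m %/ p) * p%:Z ^+ (n %/ p) * ((m %/ p)`!%:Z * (n %/ p)`!%:Z) != 0.
  by rewrite !mulf_neq0 ?expf_neq0 // eqz_nat -lt0n ?fact_gt0.
move=> h; apply: (mulIf nz); move: h.
set P1 := p%:Z ^+ (m %/ p); set P2 := p%:Z ^+ (n %/ p).
set f1 := (m %/ p)`!%:Z; set f2 := (n %/ p)`!%:Z.
set u1 := pfact p m.+1; set u2 := pfact p n.+1; set u3 := pfact p (m + n).+1.
set c1 := Posz 'C(m + n, m) => h.
have -> : c1 * (u1 * u2) * (P1 * P2 * (f1 * f2)) = c1 * (u1 * P1 * f1 * (u2 * P2 * f2)) by ring.
by rewrite h; ring.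
Qed.
End BinPfact.

(** * The analytic extension of the ratio *)

(** Substituting x ^ p inserts p - 1 zeros between consecutive coefficients.
    *)
Lemma ps_expand_sum (K : fieldType) p (h : nat -> K) D x : (0 < p)%N ->
  \sum_(k < D) h k * (x ^+ p) ^+ k = \sum_(i < D * p) ps_expand p h i * x ^+ i.
Proof.
move=> p0; rewrite -(horner_poly D h); set q := \poly_(k < D) h k.
have sq : (size (q \Po 'X^p) <= D * p)%N.
  by rewrite comp_poly_Xn //; apply: leq_trans (size_poly _ _) _; rewrite leq_mul2r size_poly orbT.
have -> : q.[x ^+ p] = (q \Po 'X^p).[x] by rewrite horner_comp hornerXn.
rewrite (horner_coef_wide _ sq); apply: eq_bigr => i _; congr (_ * _).
rewrite coef_comp_poly_Xn // /ps_expand coef_poly ltn_divLR // ltn_ord.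
by case: ifP.
Qed.

Section Trunc.
Variables (p : nat) (R : realType) (K : closedFieldType) (v : K -> R).
Hypotheses (p_prime : prime p) (Cp : is_Cp p v).
Variables al be ga : nat -> nat.
Hypothesis sum_le : forall i, (al i + be i <= ga i)%N.
Hypothesis ga_lt : forall i, (ga i < p)%N.
Local Notation pabs := (pabs p R).

Let be_lt i : (be i < p)%N.
Proof. by have := sum_le i; have := ga_lt i; lia. Qed.
Let al_ga i : (al i <= ga i)%N. Proof. by have := sum_le i; lia. Qed.
Let be_ga i : (be i <= ga i)%N. Proof. by have := sum_le i; lia. Qed.

(** The generating polynomial of the hypergeometric polynomial for a single
    digit. *)
Definition Gfac i := hyperG (al i) (ga i).

Lemma size_Gfac i : (size (Gfac i) <= p)%N.
Proof. exact: leq_trans (size_hyperG (al_ga i)) (ga_lt i). Qed.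

Lemma digsum_add d1 d2 k n :
  digsum p (fun i => d1 i + d2 i)%N k n = (digsum p d1 k n + digsum p d2 k n)%N.
Proof. by rewrite /digsum -big_split /=; apply: eq_bigr => j _; rewrite mulnDl. Qed.

Lemma digsum_ext d1 d2 k n : d1 =1 d2 -> digsum p d1 k n = digsum p d2 k n.
Proof. by move=> e; apply: eq_bigr => j _; rewrite e. Qed.

Lemma digsum_leq d1 d2 k n : (forall i, d1 i <= d2 i)%N -> (digsum p d1 k n <= digsum p d2 k n)%N.
Proof. by move=> e; apply: leq_sum => j _; rewrite leq_mul2r e orbT. Qed.

Lemma digsum_sub d1 d2 k n : (forall i, d1 i <= d2 i)%N ->
  digsum p (fun i => d2 i - d1 i)%N k n = (digsum p d2 k n - digsum p d1 k n)%N.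
Proof.
move=> h; have -> : digsum p d2 k n = (digsum p d1 k n + digsum p (fun i => d2 i - d1 i) k n)%N.
  by rewrite -digsum_add; apply: digsum_ext => i; rewrite subnKC.
by rewrite addKn.
Qed.

(** Exponents written in base p multiply out to a product over the digits. *)
Lemma Gprod_hyperG k n : Gprod p Gfac k n = hyperG (digsum p al k n) (digsum p ga k n).
Proof.
rewrite /hyperG -digsum_sub //; elim: n => [|n IH].
  by rewrite Gprod0 !digsum0 !expr0 mulr1.
by rewrite GprodS IH /Gfac /hyperG exprMn -!exprM !digsumS !exprD; ring.
Qed.

Lemma cpoly_hyperpoly k n :
  cpoly p Gfac be k n = hyperpoly (digsum p al k n) (digsum p be k n) (digsum p ga k n).
Proof. by rewrite /cpoly Gprod_hyperG. Qed.

Definition admissible (t : 'I_p * 'I_p * 'I_p) : bool := (t.1.1 + t.1.2 <= t.2)%N.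
(** All triples of digits that can occur in a hypothesis of the form al + be
    <= ga < p are included, so that one polynomial governs every place of the
    expansions. *)
Definition residue_prod : {poly int} := \prod_(t | admissible t) hyperpoly t.1.1 t.1.2 t.2.

Lemma v_prod_eq1 (I : finType) (P : pred I) (F : I -> K) :
  (forall i, v (F i) <= 1) -> v (\prod_(i | P i) F i) = 1 -> forall i, P i -> v (F i) = 1.
Proof.
move=> h e i Pi; apply/eqP; rewrite eq_le h /= -e (bigD1 i) //= (vM Cp).
rewrite ler_piMr ?(Cp_abs_ge0 Cp) //.
by elim/big_rec: _ => [|j x _ hx]; [rewrite (v1 Cp) | apply: (vM_le1 Cp)].
Qed.

Definition ratio_dom : set K := unit_locus v residue_prod.

Lemma v_residue_prod0 : v (ev 0 residue_prod) = 1.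
Proof.
rewrite /residue_prod ev_prod (v_prod Cp) big1 // => -[[A B] C]; rewrite /admissible /= => h.
by rewrite ev0_hyperpoly ?(v_bin_small p_prime Cp) ?ltn_ord //; lia.
Qed.

Lemma v_residue_prod1 : v (ev 1 residue_prod) = 1.
Proof.
rewrite /residue_prod ev_prod (v_prod Cp) big1 // => -[[A B] C]; rewrite /admissible /= => h.
have := ltn_ord C; rewrite ev1_hyperpoly => hC; rewrite (v_bin_small p_prime Cp) //; lia.
Qed.

Lemma ratio_dom0 : ratio_dom 0.
Proof. by split; rewrite ?v_residue_prod0 // (v0 Cp) ler01. Qed.
Lemma ratio_dom1 : ratio_dom 1.
Proof. by split; rewrite ?v_residue_prod1 // (v1 Cp). Qed.
Lemma ratio_dom_residue : residue_domain v ratio_dom.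
Proof. exact: (unit_locus_residue Cp) v_residue_prod0. Qed.
Lemma open_disk_ratio_dom x : ratio_dom x -> open_unit_disk v x `<=` ratio_dom.
Proof. by move=> dx y yx; apply: (unit_locus_near Cp _ yx dx); case: dx. Qed.

(** Modulo p, the value of an integral polynomial at y ^ (p ^ m) is the p ^
    m-th power of its value at y. *)
Lemma unit_frob y m (h : {poly int}) : v y <= 1 -> v (ev y h) = 1 -> v (ev (y ^+ (p ^ m)) h) = 1.
Proof.
move=> hy hh; rewrite -ev_comp.
have [z ez] := frob_twist p_prime m h.
have e1 : v (ev y h ^+ (p ^ m)) = 1 by rewrite (vX Cp) hh expr1n.
apply: (v_unit_of_lt Cp e1); rewrite (vBC Cp) -evX -evB ez evMn.
apply: (@le_lt_trans _ _ (pabs 1)); last by rewrite -(pabs0 p R) pabs_lt.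
by apply: (v_pmulr Cp); apply: (v_ev Cp).
Qed.

Lemma ratio_dom_unit y : ratio_dom y -> unit_at p v Gfac be y.
Proof.
move=> [hy Hy]; apply: (unit_atP p_prime Cp size_Gfac be_lt hy) => k m.
rewrite -/(hyperpoly _ _ _); apply: unit_frob => //.
have al_lt : (al k < p)%N by apply: leq_ltn_trans (ga_lt k).
move: Hy; rewrite /residue_prod ev_prod => /(v_prod_eq1 (fun t => v_ev Cp _ hy)).
by move=> /(_ (Ordinal al_lt, Ordinal (be_lt k), Ordinal (ga_lt k))); apply; exact: sum_le.
Qed.

(** The polynomial with the first n + 1 digits, over the polynomial with the
    digits 1 to n at y ^ p. The normalization by the constant terms is
    deferred to [ratio_ext]. *)
Definition ratio_n (n : nat) (y : K) : K :=
  cval p Gfac be y 0 0 n.+1 / cval p Gfac be y 1 1 n.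

Lemma ratio_n_step y n : ratio_dom y -> v (ratio_n n.+1 y - ratio_n n y) <= pabs n.
Proof.
move=> dy; apply: (@le_trans _ _ (pabs n.+1)); last exact: pabs_le.
by apply: (dwork_ratio p_prime Cp size_Gfac be_lt) (ratio_dom_unit dy); case: dy.
Qed.

Lemma v_ratio_n y n : ratio_dom y -> v (ratio_n n y) = 1.
Proof. by move=> dy; rewrite /ratio_n (v_div_unit Cp) !(ratio_dom_unit dy). Qed.

Definition ratio_lim (y : K) : K := vlimit v (fun n => ratio_n n y).
(** Division by the value at 0 replaces 'C(L, M) F(- N, - M, - L; y) by F(- N,
    - M, - L; y) in the numerator and in the denominator of the
    approximations. *)
Definition ratio_ext (y : K) : K := ratio_lim y / ratio_lim 0.

Lemma ratio_limP y : ratio_dom y ->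
  [/\ v (ratio_lim y) = 1 & forall n, v (ratio_n n y - ratio_lim y) <= pabs n].
Proof.
move=> dy; have [h1 h2] := vlimitP p_prime Cp (fun n => ratio_n_step n dy).
by split => //; apply: (vlim_unit Cp h1) => n; apply: v_ratio_n.
Qed.

Lemma ratio_ext_approx y n : ratio_dom y -> v (ratio_n n y / ratio_n n 0 - ratio_ext y) <= pabs n.
Proof.
move=> dy; have [u1 h1] := ratio_limP dy; have [u0 h0] := ratio_limP ratio_dom0.
apply: (@vM_dist _ _ _ _ Cp _ _ _ _ _ 1 1).
- by rewrite v_ratio_n.
- by rewrite (vV Cp) u0 invr1.
- exact/ltW/pabs_gt0.
- by rewrite mulr1 (v_inv_dist Cp) ?v_ratio_n //; exact: ratio_dom0.
- by rewrite mulr1.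
Qed.

(** The approximations [ratio_n] are rational functions whose denominators
    have absolute value 1 on the domain. *)
Lemma ratio_ext_analytic : analytic_element v ratio_dom ratio_ext.
Proof.
move=> e e0; have [n hn] := pabs_small p_prime e0.
pose Q : {poly K} := map_poly intr (cpoly p Gfac be 1 n) \Po 'X^p.
exists ((ratio_n n 0)^-1 *: map_poly intr (cpoly p Gfac be 0 n.+1)), Q.
have hQ y : Q.[y] = cval p Gfac be y 1 1 n.
  by rewrite /Q horner_comp hornerXn /cval /ev expn1.
split=> y dy.
  by rewrite hQ; apply: (v_neq0_of Cp); apply: ratio_dom_unit.
rewrite hQ hornerZ (vBC Cp); apply: le_lt_trans hn.
have -> : (map_poly intr (cpoly p Gfac be 0 n.+1)).[y] = cval p Gfac be y 0 0 n.+1.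
  by rewrite /cval expn0 expr1.
have := ratio_ext_approx n dy; rewrite /ratio_n.
by rewrite [_^-1 * cval _ _ _ _ _ _ _]mulrC mulrAC.
Qed.

Definition num_coef n := hypergeom (- (digsum p al 0 n.+1)%:R : K) (- (digsum p be 0 n.+1)%:R)
  (- (digsum p ga 0 n.+1)%:R).
Definition den_coef n := hypergeom (- (digsum p al 1 n)%:R : K) (- (digsum p be 1 n)%:R)
  (- (digsum p ga 1 n)%:R).

Lemma cval_series y k n D : (digsum p al k n < D)%N ->
  cval p Gfac be y k k n = cval p Gfac be 0 k k n *
    \sum_(i < D) hypergeom (- (digsum p al k n)%:R : K) (- (digsum p be k n)%:R)
        (- (digsum p ga k n)%:R) i * (y ^+ (p ^ k)) ^+ i.
Proof.
move=> lt; rewrite /cval cpoly_hyperpoly (@ev_hyperpoly_sum _ _ _ _ _ D) ?digsum_leq //.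
have q0 : (0 < p ^ k)%N by rewrite expn_gt0 prime_gt0.
rewrite expr0n (gtn_eqF q0) ev0_hyperpoly ?digsum_leq // mulr_sumr.
apply: eq_bigr => i _; rewrite (hyperpoly_coefE p_prime Cp) ?digsum_leq //. by rewrite -mulrA.
Qed.

Lemma cval0 k n : cval p Gfac be (0 : K) k k n = 'C(digsum p ga k n, digsum p be k n)%:R.
Proof.
have q0 : (0 < p ^ k)%N by rewrite expn_gt0 prime_gt0.
by rewrite /cval cpoly_hyperpoly expr0n (gtn_eqF q0) ev0_hyperpoly ?digsum_leq.
Qed.

Lemma cval1 k n : cval p Gfac be (1 : K) k k n =
  'C(digsum p ga k n - digsum p al k n, digsum p be k n)%:R.
Proof. by rewrite /cval cpoly_hyperpoly expr1n ev1_hyperpoly. Qed.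

Lemma v_hyper_le1 k n i : v (hypergeom (- (digsum p al k n)%:R : K) (- (digsum p be k n)%:R)
        (- (digsum p ga k n)%:R) i) <= 1.
Proof.
have u : v 'C(digsum p ga k n, digsum p be k n)%:R = 1.
  by rewrite -cval0; apply: ratio_dom_unit ratio_dom0 _ _ _.
have := v_hyperpoly_coef Cp (digsum p al k n) (digsum p be k n) (digsum p ga k n) i.
by rewrite (hyperpoly_coefE p_prime Cp) ?digsum_leq // (vM Cp) u mul1r.
Qed.

Lemma ratio_n_series y n D : (digsum p al 0 n.+1 < D)%N -> (digsum p al 1 n < D)%N ->
  ratio_n n y / ratio_n n 0 =
  (\sum_(i < D * p) num_coef n i * y ^+ i) / (\sum_(i < D * p) ps_expand p (den_coef n) i * y ^+ i).
Proof.
move=> h0 h1; have p0 := prime_gt0 p_prime.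
have h0' : (digsum p al 0 n.+1 < D * p)%N by apply: leq_trans h0 _; rewrite leq_pmulr.
rewrite /ratio_n (@cval_series y _ _ _ h0') (@cval_series y _ _ _ h1) expn1 expn0 expr1.
rewrite -/(num_coef n) -/(den_coef n) ps_expand_sum //.
have u k m : cval p Gfac be (0 : K) k k m != 0 :> K.
  by apply: (v_neq0_of Cp); apply: ratio_dom_unit ratio_dom0 _ _ _.
set X := \sum_(i < _) _; set Y := \sum_(i < _) _.
have := u 0%N n.+1; have := u 1%N n.
set c1 := cval _ _ _ _ 1 _ _; set c0 := cval _ _ _ _ 0 _ _ => z1 z0.
have [->|Y0] := eqVneq Y 0; first by rewrite mulr0 !invr0 !mulr0 mul0r.
by field; rewrite z0 z1 Y0.
Qed.

(** For fixed n, the n-th partial sum is compared with the rational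
    approximation s through [expansion_approx], where s is so large that the
    coefficients of index below n of the truncated polynomials are close to
    their limits. *)
Lemma ratio_ext_expansion (F E : nat -> K) :
  (forall k, vlim v (fun n => num_coef n k) (F k)) ->
  (forall k, vlim v (fun n => ps_expand p (den_coef n) k) (E k)) ->
  has_expansion_at0 v ratio_ext (ps_quot F E).
Proof.
move=> hF hE x; rewrite /open_unit_disk /= subr0 => x1 e e0.
have p0 := prime_gt0 p_prime.
have dx : ratio_dom x by apply: (open_disk_ratio_dom ratio_dom0); rewrite /open_unit_disk /= subr0.
have F1 n i : v (num_coef n i) <= 1 by exact: v_hyper_le1.
have H1 n i : v (ps_expand p (den_coef n) i) <= 1.
  rewrite /ps_expand; case: ifP => _; first exact: v_hyper_le1.
  by rewrite (v0 Cp).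
have E0 : v (E 0%N) = 1.
  apply: (vlim_unit Cp (hE 0%N)) => n.
  by rewrite /ps_expand dvdn0 div0n /den_coef /hypergeom !pochhammer0 fact0 mulr1n !mulr1 divr1 (v1 Cp).
have [m hm] := geom_small (Cp_abs_ge0 Cp x) x1 e0.
exists m => n mn.
have [j hj] := pabs_small p_prime e0.
have j0 := pabs_gt0 R p_prime j.
have [N1 hN1] := vlim_unif n hF j0.
have [N2 hN2] := vlim_unif n hE j0.
pose s := maxn j (maxn N1 N2).
have js : (j <= s)%N by rewrite leq_maxl.
have N1s : (N1 <= s)%N by rewrite /s !leq_max leqnn orbT.
have N2s : (N2 <= s)%N by rewrite /s !leq_max leqnn !orbT.
(* The rational approximation is within |p| ^ s of the limit. *)
apply: (v_dist_lt Cp (z := ratio_n s x / ratio_n s 0)); last first.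
  apply: le_lt_trans (ratio_ext_approx s dx) _.
  by apply: le_lt_trans hj; apply: pabs_le.
(* D exceeds the degrees of both truncated polynomials. *)
pose D := (digsum p al 0 s.+1 + digsum p al 1 s + n).+1.
have D0 : (digsum p al 0 s.+1 < D)%N by rewrite /D; lia.
have D1 : (digsum p al 1 s < D)%N by rewrite /D; lia.
have nD : (n <= D * p)%N by apply: (@leq_trans D); rewrite ?leq_pmulr // /D; lia.
rewrite (ratio_n_series _ D0 D1).
have vY : v (\sum_(i < D * p) ps_expand p (den_coef s) i * x ^+ i) = 1.
  have := ratio_dom_unit dx 1 1 s; rewrite (@cval_series x _ _ _ D1) expn1 -/(den_coef s) ps_expand_sum //.
  by rewrite (vM Cp) (ratio_dom_unit ratio_dom0) mul1r.
have Y0 := v_neq0_of Cp vY.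
have bound := expansion_approx Cp (fun i => vlim_bound Cp (hF i) (F1^~ i))
  (fun i => vlim_bound Cp (hE i) (H1^~ i)) E0 (F1 s) (H1 s) (ltW x1) nD (ltW j0)
  (fun i ni => ltW (hN1 s N1s i ni)) (fun i ni => ltW (hN2 s N2s i ni)).
move: Y0 vY bound; set Y := \sum_(i < D * p) _ * _; set X := \sum_(i < D * p) _ * _.
set A := \sum_(i < n) _ => Y0 vY bound.
have -> : A - X / Y = (A * Y - X) / Y by field.
rewrite (v_div_unit Cp) //; apply: le_lt_trans bound _.
by rewrite gt_max hj hm.
Qed.

Lemma digsum_modp d n : (d 0%N < p)%N -> (digsum p d 0 n.+1 %% p = d 0)%N.
Proof. by move=> h; rewrite -add1n digsumD digsum1 addnC mulnC modnMDl modn_small. Qed.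
Lemma digsum_divp d n : (d 0%N < p)%N -> (digsum p d 0 n.+1 %/ p = digsum p d 1 n)%N.
Proof.
move=> h; rewrite -add1n digsumD digsum1 expn1 addnC mulnC divnMDl ?prime_gt0 //.
by rewrite divn_small ?addn0.
Qed.

Local Notation U n := ((pfact p n.+1)%:~R : K).

Lemma bin_digsum d1 d2 n : (forall i, d1 i + d2 i < p)%N ->
  'C(digsum p d1 0 n.+1 + digsum p d2 0 n.+1, digsum p d1 0 n.+1)%:R /
  'C(digsum p d1 1 n + digsum p d2 1 n, digsum p d1 1 n)%:R
  = U (digsum p d1 0 n.+1 + digsum p d2 0 n.+1) /
    (U (digsum p d1 0 n.+1) * U (digsum p d2 0 n.+1)).
Proof.
move=> h; have h1 : (d1 0 < p)%N by have := h 0%N; lia.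
have h2 : (d2 0 < p)%N by have := h 0%N; lia.
have lt : (digsum p d1 0 n.+1 %% p + digsum p d2 0 n.+1 %% p < p)%N.
  by rewrite !digsum_modp.
have := bin_pfact p_prime lt; rewrite !digsum_divp //.
move/(congr1 (intr : int -> K)); rewrite !rmorphM /= -!pmulrn => e.
have z1 : U (digsum p d1 0 n.+1) != 0 by apply: (v_neq0_of Cp); apply: (v_pfact p_prime Cp).
have z2 : U (digsum p d2 0 n.+1) != 0 by apply: (v_neq0_of Cp); apply: (v_pfact p_prime Cp).
have z3 : 'C(digsum p d1 1 n + digsum p d2 1 n, digsum p d1 1 n)%:R != 0 :> K.
  by apply: (natK_neq0 p_prime Cp); rewrite bin_gt0 leq_addr.
by apply/eqP; rewrite eqr_div ?mulf_neq0 //; apply/eqP.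
Qed.

(** The digits of a + b - c, when there is no borrow. *)
Definition rest_digit i := (ga i - al i - be i)%N.

Lemma ratio_n_at1 n :
  ratio_n n 1 / ratio_n n 0 =
  U (digsum p be 0 n.+1 + digsum p rest_digit 0 n.+1) * U (digsum p al 0 n.+1 + digsum p rest_digit 0 n.+1) /
  (U (digsum p ga 0 n.+1) * U (digsum p rest_digit 0 n.+1)).
Proof.
pose ga_be i := (al i + rest_digit i)%N.
have ga1 k m : digsum p ga k m = (digsum p be k m + digsum p ga_be k m)%N.
  rewrite -digsum_add; apply: digsum_ext => i; rewrite /ga_be /rest_digit.
  by have := sum_le i; lia.
have ga2 k m : digsum p ga_be k m = (digsum p al k m + digsum p rest_digit k m)%N.
  by rewrite -digsum_add.
have ga3 k m : (digsum p ga k m - digsum p al k m = digsum p be k m + digsum p rest_digit k m)%N.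
  by rewrite ga1 ga2; lia.
rewrite /ratio_n !cval0 !cval1 !ga3 ga1 (ga1 1%N) !bin_digsum; first last.
- by move=> i; rewrite /rest_digit; have := sum_le i; have := ga_lt i; lia.
- by move=> i; rewrite /ga_be /rest_digit; have := sum_le i; have := ga_lt i; lia.
have nz m : U m != 0 by apply: (v_neq0_of Cp); apply: (v_pfact p_prime Cp).
rewrite -!ga2; move: (nz (digsum p be 0 n.+1)) (nz (digsum p ga_be 0 n.+1)) (nz (digsum p rest_digit 0 n.+1)).
move: (nz (digsum p be 0 n.+1 + digsum p ga_be 0 n.+1)%N).
set u1 := U _; set u2 := U _; set u3 := U _; set u4 := U _; set u5 := U _ => z1 z2 z3 z4.
by field; rewrite z1 z2 z3 z4.
Qed.
End Trunc.

(** * The value at 1 *)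

(** The identity between [theta], [Gamma_trunc] and [pfact] behind the
    evaluation at 1: g are values of Morita's function, u products of integers
    prime to p, s signs. *)
Lemma cancel_gammas (K : fieldType) (g1 g2 g3 g4 u1 u2 u3 u4 s1 s2 s3 s4 : K) :
  g1 != 0 -> g2 != 0 -> g3 != 0 -> g4 != 0 -> u3 != 0 -> u4 != 0 -> s3 != 0 -> s4 != 0 ->
  s3 * s4 = s1 * s2 ->
  (g1 * u1 * s1 * (g2 * u2 * s2)) / (g3 * u3 * s3 * (g4 * u4 * s4)) * (g3 * g4 / (g1 * g2))
    = u1 * u2 / (u3 * u4).
Proof.
move=> g1z g2z g3z g4z u3z u4z s3z s4z ss.
transitivity (u1 * u2 / (u3 * u4) * (s1 * s2 / (s3 * s4))).
  by field; rewrite g1z g2z g3z g4z u3z u4z s3z s4z.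
by rewrite -ss divff ?mulr1 // mulf_neq0.
Qed.

Section Value.
Variables (p : nat) (R : realType) (K : closedFieldType) (v : K -> R).
Hypotheses (p_prime : prime p) (p_odd : odd p) (Cp : is_Cp p v).
Local Notation pabs := (pabs p R).
Local Notation U n := ((pfact p n.+1)%:~R : K).

(** Morita's function at a natural number close to - digsum p d 0 (n + 1). *)
Definition Gamma_trunc (d : nat -> nat) (n : nat) : K := Gamma_nat p K (p ^ n.+1 - digsum p d 0 n.+1).
(** The defect in the reflection formula for the first n + 1 digits; it tends
    to 1. *)
Definition theta (d : nat -> nat) (n : nat) : K :=
  Gamma_trunc d n * U (digsum p d 0 n.+1) * (-1) ^+ digsum p d 1 n.

Lemma theta_lim d : (forall i, d i < p)%N -> vlim v (theta d) 1.
Proof.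
move=> dp; apply: (vlim_rate p_prime) => n.
have le : (digsum p d 0 n.+1 <= p ^ n.+1)%N by rewrite ltnW // digsum_lt.
have := Gamma_reflect p_prime p_odd Cp le; rewrite digsum_divp //.
rewrite -/(Gamma_trunc d n) => h.
apply: (@le_trans _ _ (pabs n.+1)); last exact: pabs_le.
apply: le_trans h; rewrite le_eqVlt; apply/orP; left; apply/eqP.
rewrite -[RHS]mulr1 -(v_sign Cp (digsum p d 1 n)) -(vM Cp) mulrBl /theta.
have -> : (-1) ^+ digsum p d 1 n * (-1) ^+ digsum p d 1 n = 1 :> K.
  by rewrite -exprD addnn -signr_odd odd_double.
by [].
Qed.

Lemma Gamma_trunc_lim d x : (forall i, d i < p)%N ->
  (forall n, v (x + (digsum p d 0 n)%:R) <= pabs n) -> vlim v (Gamma_trunc d) (Gamma_p p v x).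
Proof.
move=> dp hx; apply: (Gamma_p_lim p_prime p_odd Cp (u := fun n => p ^ n.+1 - digsum p d 0 n.+1)%N) => n.
apply: (@le_trans _ _ (pabs n.+1)); last exact: pabs_le.
rewrite natrB; last by rewrite ltnW // digsum_lt.
rewrite -addrA -opprD; apply: (vB_le Cp); first by rewrite natrX (v_pX Cp).
by rewrite addrC.
Qed.

Lemma Gamma_p_neq0 d x : (forall i, d i < p)%N ->
  (forall n, v (x + (digsum p d 0 n)%:R) <= pabs n) -> Gamma_p p v x != 0.
Proof.
move=> dp hx; apply: (v_neq0_of Cp); apply: (vlim_unit Cp (Gamma_trunc_lim dp hx)) => n.
exact: v_Gamma_nat.
Qed.

End Value.

Theorem mainTheorem1 (p : nat) (R : realType) (K : closedFieldType) (v : K -> R)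
    (p_prime : prime p) (Cp : is_Cp p v) (a b c : K)
    (Zp_a : padic_int v a) (Zp_b : padic_int v b) (Zp_c : padic_int v c)
    (mu_ab : forall i : nat,
      (0 < minn (mu p v (dprime_iter p v i a)) (mu p v (dprime_iter p v i b)))%N)
    (mu_c : forall i : nat,
      (mu p v (dprime_iter p v i a) + mu p v (dprime_iter p v i b)
         < mu p v (dprime_iter p v i c))%N) :
  extends_to v (hypergeom_ratio p v a b c) (open_unit_disk v 1) /\
  calF p v a b c 1 =
    (Gamma_p p v c * Gamma_p p v (c - a - b)) /
    (Gamma_p p v (c - a) * Gamma_p p v (c - b)).
Proof.
pose al := digit p v a; pose be := digit p v b; pose ga := digit p v c.
have sum_le i : (al i + be i <= ga i)%N by rewrite ltnW // mu_c.
have ga_lt i : (ga i < p)%N by apply: digit_lt.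
have ga_gt0 i : (0 < ga i)%N by apply: leq_ltn_trans (mu_c i).
(* The digits of index 0 satisfy 1 + 1 < mu_c < p. *)
have p_odd : odd p.
  have /andP[a0 b0] : (0 < al 0)%N && (0 < be 0)%N by rewrite -leq_min; apply: mu_ab.
  have c0 : (al 0 + be 0 < ga 0)%N := mu_c 0%N.
  have := ga_lt 0%N; case: (even_prime p_prime) => // ->; lia.
pose g := hypergeom_ratio p v a b c.
pose S := ratio_dom p v; pose f := ratio_ext p v al be ga.
have ext_f : analytic_extension v g S f.
  split.
  - exact: ratio_dom_residue.
  - exact/(open_disk_ratio_dom Cp)/ratio_dom0.
  - exact: ratio_ext_analytic.
  - apply: (ratio_ext_expansion p_prime Cp sum_le ga_lt) => k.
      apply: (hypergeom_vlim p_prime Cp) (pochhammer_neq0 p_prime Cp 0 k Zp_c ga_gt0);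
        exact: (neg_digsum_vlim p_prime Cp 0 1).
    rewrite /ps_expand; case: ifP => _; last exact: (vlim_cst Cp).
    apply: (hypergeom_vlim p_prime Cp) (pochhammer_neq0 p_prime Cp 1 (k %/ p) Zp_c ga_gt0);
      exact: (neg_digsum_vlim p_prime Cp 1 0).
have S1 : S 1 by exact: ratio_dom1.
split; first by exists S, f; split => //; apply: (open_disk_ratio_dom Cp).
have -> : calF p v a b c 1 = f 1.
  apply: xget_unique; first by exists S, f.
  move=> y [S' [f' [[dS' US' aS' exp'] S'1 <-]]]; have [dS US aS exp] := ext_f.
  apply: (analytic_element_uniq p_prime Cp dS' dS US' US aS' aS) => // x Ux.
  exact: (vlim_uniq Cp (exp' x Ux) (exp x Ux)).
pose e := rest_digit al be ga.
have e_lt i : (e i < p)%N by rewrite /e /rest_digit; have := ga_lt i; lia.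
pose d1 i := (be i + e i)%N; pose d2 i := (al i + e i)%N.
have d1_lt i : (d1 i < p)%N by rewrite /d1 /e /rest_digit; have := ga_lt i; have := sum_le i; lia.
have d2_lt i : (d2 i < p)%N by rewrite /d2 /e /rest_digit; have := ga_lt i; have := sum_le i; lia.
have ha n : v (a + (digsum p al 0 n)%:R) <= pabs p R n by apply: (digit_approx p_prime Cp 0).
have hb n : v (b + (digsum p be 0 n)%:R) <= pabs p R n by apply: (digit_approx p_prime Cp 0).
have hc n : v (c + (digsum p ga 0 n)%:R) <= pabs p R n by apply: (digit_approx p_prime Cp 0).
have ga_d1 k n : (digsum p ga k n = digsum p al k n + digsum p d1 k n)%N.
  rewrite -digsum_add; apply: digsum_ext => i; rewrite /d1 /e /rest_digit.
  by have := sum_le i; lia.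
have ga_d2 k n : (digsum p ga k n = digsum p be k n + digsum p d2 k n)%N.
  rewrite -digsum_add; apply: digsum_ext => i; rewrite /d2 /e /rest_digit.
  by have := sum_le i; lia.
have d1_e k n : (digsum p d1 k n = digsum p be k n + digsum p e k n)%N by rewrite -digsum_add.
have d2_e k n : (digsum p d2 k n = digsum p al k n + digsum p e k n)%N by rewrite -digsum_add.
have hca n : v (c - a + (digsum p d1 0 n)%:R) <= pabs p R n.
  have -> : c - a + (digsum p d1 0 n)%:R
      = (c + (digsum p ga 0 n)%:R) - (a + (digsum p al 0 n)%:R).
    by rewrite ga_d1 natrD; ring.
  exact: (vB_le Cp).
have hcb n : v (c - b + (digsum p d2 0 n)%:R) <= pabs p R n.
  have -> : c - b + (digsum p d2 0 n)%:R
      = (c + (digsum p ga 0 n)%:R) - (b + (digsum p be 0 n)%:R).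
    by rewrite ga_d2 natrD; ring.
  exact: (vB_le Cp).
have hcab n : v (c - a - b + (digsum p e 0 n)%:R) <= pabs p R n.
  have -> : c - a - b + (digsum p e 0 n)%:R
      = (c - a + (digsum p d1 0 n)%:R) - (b + (digsum p be 0 n)%:R).
    by rewrite d1_e natrD; ring.
  exact: (vB_le Cp).
(* X n is the approximation [ratio_n] of the value at 1, written in terms of
   Morita's function. *)
pose X n := (theta p K d1 n * theta p K d2 n) / (theta p K ga n * theta p K e n) *
  ((Gamma_trunc p K ga n * Gamma_trunc p K e n) / (Gamma_trunc p K d1 n * Gamma_trunc p K d2 n)).
have X_lim : vlim v X ((1 * 1) / (1 * 1) * ((Gamma_p p v c * Gamma_p p v (c - a - b)) /
    (Gamma_p p v (c - a) * Gamma_p p v (c - b)))).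
  apply: (vlimM Cp); apply: (vlimM Cp).
  - by apply: (vlimM Cp); apply: theta_lim.
  - apply: (vlimV Cp); first by rewrite mulr1 oner_neq0.
    by apply: (vlimM Cp); apply: theta_lim.
  - by apply: (vlimM Cp); apply: Gamma_trunc_lim.
  - apply: (vlimV Cp); last by apply: (vlimM Cp); apply: Gamma_trunc_lim.
    by rewrite mulf_neq0 //; [apply: Gamma_p_neq0 hca | apply: Gamma_p_neq0 hcb].
have X_rat n : X n = ratio_n p al be ga n 1 / ratio_n p al be ga n 0.
  rewrite (ratio_n_at1 p_prime Cp sum_le ga_lt) -!digsum_add -/e -/d1 -/d2 /X /theta.
  have gz d : Gamma_trunc p K d n != 0 by apply: (v_neq0_of Cp); apply: v_Gamma_nat.
  have uz m : (pfact p m)%:~R != 0 :> K by apply: (v_neq0_of Cp); apply: v_pfact.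
  have sz m : (-1) ^+ m != 0 :> K by rewrite signr_eq0.
  (* Both sides have exponent al + be + 2 e, where e denotes the digits of a +
     b - c. *)
  have signs : (-1) ^+ digsum p ga 1 n * (-1) ^+ digsum p e 1 n
      = (-1) ^+ digsum p d1 1 n * (-1) ^+ digsum p d2 1 n :> K.
    by rewrite -!exprD ga_d1 d2_e; congr (_ ^+ _); lia.
  exact: cancel_gammas.
have f_lim : vlim v X (f 1).
  by apply: (vlim_rate p_prime) => n; rewrite X_rat; apply: ratio_ext_approx => //; exact: ratio_dom1.
rewrite (vlim_uniq Cp f_lim X_lim); by rewrite !mulr1 divr1 mul1r.
Qed.
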